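(* Let $n\ge1$, $u\in\mathbb C$ with $u\neq0$, and let $\ddot{\mathfrak H}^{\mathfrak c}$ be the rational double affine Hecke-Clifford algebra with parameter $u$. For $1\le i\le n$ set $$M_i=\sum_{k<i}(1-c_ic_k)s_{ki},\qquad z_i=u^{-1}y_ix_i+M_i\in\ddot{\mathfrak H}^{\mathfrak c}.$$ Fix $\alpha\in\mathbb C$. Then the subalgebra of $\ddot{\mathfrak H}^{\mathfrak c}$ generated by $c_i$, $\alpha x_i+z_i$ $(1\le i\le n)$ and $S_n$ is isomorphic to the degenerate affine Hecke-Clifford algebra $\mathfrak H^{\mathfrak c}$.
   Context: $S_n$ is the symmetric group, $s_{ij}\in S_n$ the transposition of $i$ and $j$, $s_i=s_{i,i+1}$. The rational double affine Hecke-Clifford algebra $\ddot{\mathfrak H}^{\mathfrak c}$ with parameter $u\in\mathbb C$ is the associative unital $\mathbb C$-algebra generated by $x_i,y_i,c_i$ ($1\le i\le n$) and $S_n$ (with the relations of the group $S_n$), subject to: $x_ix_j=x_jx_i$, $y_iy_j=y_jy_i$ for all $i,j$; $\sigma x_i=x_{\sigma(i)}\sigma$, $\sigma y_i=y_{\sigma(i)}\sigma$, $\sigma c_i=c_{\sigma(i)}\sigma$ for $\sigma\in S_n$; $c_ix_i=-x_ic_i$, $c_iy_i=y_ic_i$; $c_jx_i=x_ic_j$, $c_jy_i=y_ic_j$ for $i\neq j$; $c_i^2=1$, $c_ic_j=-c_jc_i$ for $i\neq j$; $[y_j,x_i]=u(1+c_jc_i)s_{ij}$ for $i\ne j$; $[y_i,x_i]=-u\sum_{k\neq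 i}(1+c_kc_i)s_{ki}$. The degenerate affine Hecke-Clifford algebra $\mathfrak H^{\mathfrak c}$ is the $\mathbb C$-algebra generated by $a_i,c_i$ ($1\le i\le n$) and $S_n$ (with the relations of the group $S_n$), subject to: $\sigma c_i=c_{\sigma(i)}\sigma$ ($\sigma\in S_n$), $c_i^2=1$, $c_ic_j=-c_jc_i$ ($i\ne j$), $a_js_i=s_ia_j$ ($j\ne i,i+1$), $a_{i+1}s_i-s_ia_i=1-c_{i+1}c_i$, $c_ia_i=-a_ic_i$, $a_ia_j=a_ja_i$ (all $i,j$), $c_ja_i=a_ic_j$ ($i\neq j$). *)

(* Defs.v *)
From HB Require Import structures.
From mathcomp Require Import all_boot all_fingroup all_algebra.
From mathcomp Require Import boolp.

Set Implicit Arguments.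
Unset Strict Implicit.
Unset Printing Implicit Defensive.

Import GRing.Theory.
Local Open Scope ring_scope.
Local Open Scope quotient_scope.

(* [palg rel] is the associative unital K-algebra generated by G subject to the
   relations l = r for [rel l r]: the quotient of the type [aterm K G] of formal
   noncommutative polynomial expressions by the least congruence [aeq rel] that
   contains [rel] and the axioms of K-algebras.  Its universal property is
   [palg_universal].
   Such an algebra might a priori be zero, whereas MathComp's [lalgType] and
   [algType] are restricted to nonzero rings.  Therefore [palg rel] and its
   subalgebras are declared as [pzRingType] and [lmodType K]; the algebra axioms
   linking the two structures are [palg_scalerAl] and [palg_scalerAr]. *)

(* [AScal k] stands for k times the unit. *)
Inductive aterm (K G : Type) : Type :=
| AGen of G
| AScal of K
| AAdd of aterm K G & aterm K G
| AMul of aterm K G & aterm K G.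

Arguments AGen {K G}.
Arguments AScal {K G}.

Declare Scope aterm_scope.
Delimit Scope aterm_scope with A.
Bind Scope aterm_scope with aterm.
Notation "0" := (AScal 0%R) : aterm_scope.
Notation "1" := (AScal 1%R) : aterm_scope.
Notation "p + q" := (AAdd p q) : aterm_scope.
Notation "p * q" := (AMul p q) : aterm_scope.
Notation "k *: p" := (AMul (AScal k%R) p) : aterm_scope.
Notation "- p" := (AMul (AScal (- 1)%R) p) : aterm_scope.
Notation "p - q" := (AAdd p (AMul (AScal (- 1)%R) q)) : aterm_scope.

Section PresentedAlgebra.

Variables (K : fieldType) (G : Type).
Implicit Types (k l : K) (p q r : aterm K G).

HB.instance Definition _ := gen_eqMixin (aterm K G).
HB.instance Definition _ := gen_choiceMixin (aterm K G).

Variable rel : aterm K G -> aterm K G -> Prop.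

Inductive aeq : aterm K G -> aterm K G -> Prop :=
| aeq_rel p q : rel p q -> aeq p q
| aeq_refl p : aeq p p
| aeq_sym p q : aeq p q -> aeq q p
| aeq_trans p q r : aeq p q -> aeq q r -> aeq p r
| aeq_add p p' q q' : aeq p p' -> aeq q q' -> aeq (p + q) (p' + q')
| aeq_mul p p' q q' : aeq p p' -> aeq q q' -> aeq (p * q) (p' * q')
| aeq_addA p q r : aeq (p + (q + r)) (p + q + r)
| aeq_addC p q : aeq (p + q) (q + p)
| aeq_add0 p : aeq (0 + p) p
| aeq_addN p : aeq (- p + p) 0
| aeq_mulA p q r : aeq (p * (q * r)) (p * q * r)
| aeq_mul1 p : aeq (1 * p) p
| aeq_mulDl p q r : aeq ((p + q) * r) (p * r + q * r)
| aeq_mulDr p q r : aeq (p * (q + r)) (p * q + p * r)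
| aeq_scalD k l : aeq (AScal (k + l)%R) (AScal k + AScal l)
| aeq_scalM k l : aeq (AScal (k * l)%R) (AScal k * AScal l)
| aeq_scalC k p : aeq (AScal k * p) (p * AScal k).

Definition aeqb p q : bool := `[< aeq p q >].

Lemma aeqb_equiv : equiv_class_of aeqb.
Proof.
split=> [p|p q|q p r].
- exact/asboolP/aeq_refl.
- by apply/asbool_equiv_eq; split; apply: aeq_sym.
- by move=> /asboolP pq /asboolP qr; apply/asboolP/(aeq_trans pq).
Qed.

Canonical aeqb_equivRel := EquivRelPack aeqb_equiv.

Definition palg := {eq_quot aeqb}.
HB.instance Definition _ := Choice.on palg.

Definition palg_pi p : palg := \pi_({eq_quot aeqb}) p.
Definition palg_repr (a : palg) : aterm K G :=
  generic_quotient.repr (a : {eq_quot aeqb}).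

Definition pgen (g : G) : palg := palg_pi (AGen g).

Lemma palg_reprK : cancel palg_repr palg_pi.
Proof. exact: reprK. Qed.

Lemma palg_piP p q : palg_pi p = palg_pi q <-> aeq p q.
Proof.
split; first by move=> /eqmodP/asboolP.
by move=> pq; apply/eqmodP/asboolP.
Qed.

Lemma palg_pi_rel p q : rel p q -> palg_pi p = palg_pi q.
Proof. by move=> pq; apply/palg_piP/aeq_rel. Qed.

Lemma palg_repr_pi p : aeq (palg_repr (palg_pi p)) p.
Proof. by apply/palg_piP; rewrite palg_reprK. Qed.

(* The operations are locked to keep unification from unfolding them. *)
Fact palg_key : unit. Proof. exact: tt. Qed.
Definition palg_scal : K -> palg :=
  locked_with palg_key (fun k => palg_pi (AScal k)).
Definition palg_add : palg -> palg -> palg :=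
  locked_with palg_key (fun a b => palg_pi (palg_repr a + palg_repr b)).
Definition palg_mul : palg -> palg -> palg :=
  locked_with palg_key (fun a b => palg_pi (palg_repr a * palg_repr b)).

Lemma palg_scal_pi k : palg_scal k = palg_pi (AScal k).
Proof. by rewrite /palg_scal locked_withE. Qed.

Lemma palg_add_pi p q : palg_add (palg_pi p) (palg_pi q) = palg_pi (p + q).
Proof.
by rewrite /palg_add locked_withE; apply/palg_piP/aeq_add; apply: palg_repr_pi.
Qed.

Lemma palg_mul_pi p q : palg_mul (palg_pi p) (palg_pi q) = palg_pi (p * q).
Proof.
by rewrite /palg_mul locked_withE; apply/palg_piP/aeq_mul; apply: palg_repr_pi.
Qed.

Let palg_piE := (palg_scal_pi, palg_add_pi, palg_mul_pi).

Fact palg_addA : associative palg_add.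
Proof.
move=> a b c; rewrite -[a]palg_reprK -[b]palg_reprK -[c]palg_reprK !palg_piE.
exact/palg_piP/aeq_addA.
Qed.

Fact palg_addC : commutative palg_add.
Proof.
move=> a b; rewrite -[a]palg_reprK -[b]palg_reprK !palg_piE.
exact/palg_piP/aeq_addC.
Qed.

Fact palg_add0 : left_id (palg_scal 0) palg_add.
Proof.
by move=> a; rewrite -[a]palg_reprK !palg_piE; apply/palg_piP/aeq_add0.
Qed.

Fact palg_addN :
  left_inverse (palg_scal 0) (palg_mul (palg_scal (- 1))) palg_add.
Proof.
by move=> a; rewrite -[a]palg_reprK !palg_piE; apply/palg_piP/aeq_addN.
Qed.

HB.instance Definition _ := GRing.isZmodule.Build palg
  palg_addA palg_addC palg_add0 palg_addN.

Fact palg_mulA : associative palg_mul.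
Proof.
move=> a b c; rewrite -[a]palg_reprK -[b]palg_reprK -[c]palg_reprK !palg_piE.
exact/palg_piP/aeq_mulA.
Qed.

Fact palg_scalC k a : palg_mul (palg_scal k) a = palg_mul a (palg_scal k).
Proof. by rewrite -[a]palg_reprK !palg_piE; apply/palg_piP/aeq_scalC. Qed.

Fact palg_mul1l : left_id (palg_scal 1) palg_mul.
Proof.
by move=> a; rewrite -[a]palg_reprK !palg_piE; apply/palg_piP/aeq_mul1.
Qed.

Fact palg_mul1r : right_id (palg_scal 1) palg_mul.
Proof. by move=> a; rewrite -palg_scalC palg_mul1l. Qed.

Fact palg_mulDl : left_distributive palg_mul palg_add.
Proof.
move=> a b c; rewrite -[a]palg_reprK -[b]palg_reprK -[c]palg_reprK !palg_piE.
exact/palg_piP/aeq_mulDl.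
Qed.

Fact palg_mulDr : right_distributive palg_mul palg_add.
Proof.
move=> a b c; rewrite -[a]palg_reprK -[b]palg_reprK -[c]palg_reprK !palg_piE.
exact/palg_piP/aeq_mulDr.
Qed.

HB.instance Definition _ := GRing.Zmodule_isPzRing.Build palg
  palg_mulA palg_mul1l palg_mul1r palg_mulDl palg_mulDr.

Fact palg_scalD : {morph palg_scal : k l / k + l >-> k + l}.
Proof.
by move=> k l; rewrite -[RHS]/(palg_add _ _) !palg_piE;
  apply/palg_piP/aeq_scalD.
Qed.

Fact palg_scalM : {morph palg_scal : k l / k * l >-> k * l}.
Proof.
by move=> k l; rewrite -[RHS]/(palg_mul _ _) !palg_piE;
  apply/palg_piP/aeq_scalM.
Qed.

Definition palg_scale k (a : palg) : palg := palg_scal k * a.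

Fact palg_scaleA k l a : palg_scale k (palg_scale l a) = palg_scale (k * l) a.
Proof. by rewrite /palg_scale palg_scalM mulrA. Qed.

Fact palg_scale1 : left_id 1 palg_scale.
Proof. exact: palg_mul1l. Qed.

Fact palg_scaleDr : right_distributive palg_scale +%R.
Proof. by move=> k a b; apply: mulrDr. Qed.

Fact palg_scaleDl a : {morph palg_scale^~ a : k l / k + l}.
Proof. by move=> k l; rewrite /palg_scale palg_scalD mulrDl. Qed.

HB.instance Definition _ := GRing.Zmodule_isLmodule.Build K palg
  palg_scaleA palg_scale1 palg_scaleDr palg_scaleDl.

Lemma palg_piS k : palg_pi (AScal k) = k *: (1 : palg).
Proof. by rewrite -palg_scal_pi -[RHS]/(palg_scal k * 1) mulr1. Qed.

Lemma palg_pi0 : palg_pi 0 = 0.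
Proof. exact/esym/palg_scal_pi. Qed.

Lemma palg_pi1 : palg_pi 1 = 1.
Proof. exact/esym/palg_scal_pi. Qed.

Lemma palg_piD p q : palg_pi (p + q) = palg_pi p + palg_pi q.
Proof. exact/esym/palg_add_pi. Qed.

Lemma palg_piM p q : palg_pi (p * q) = palg_pi p * palg_pi q.
Proof. exact/esym/palg_mul_pi. Qed.

Lemma palg_scalerAl k (a b : palg) : k *: (a * b) = (k *: a) * b.
Proof. exact: mulrA. Qed.

Lemma palg_scalerAr k (a b : palg) : k *: (a * b) = a * (k *: b).
Proof.
rewrite -[LHS]/(palg_scal k * (a * b)) -[k *: b]/(palg_scal k * b) !mulrA.
by congr (_ * b); apply: palg_scalC.
Qed.

(* A K-algebra is given here as a ring A with a ring morphism phi from K to the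
   center of A. *)
Section UniversalProperty.

Variables (A : pzRingType) (phi : {rmorphism K -> A}) (h : G -> A).

Fixpoint aeval (p : aterm K G) : A :=
  match p with
  | AGen g => h g
  | AScal k => phi k
  | AAdd p q => aeval p + aeval q
  | AMul p q => aeval p * aeval q
  end.

Hypothesis phiC : forall k a, phi k * a = a * phi k.
Hypothesis aeval_rel : forall p q, rel p q -> aeval p = aeval q.

Lemma aeval_aeq p q : aeq p q -> aeval p = aeval q.
Proof.
elim=> {p q} /= [p q /aeval_rel|p|p q _|p q r _ -> _ ->|p p' q q' _ -> _ ->|
                 p p' q q' _ -> _ ->|p q r|p q|p|p|p q r|p|p q r|p q r|k l|k l|
                 k p] //.
- exact: addrA.
- exact: addrC.
- by rewrite rmorph0 add0r.
- by rewrite rmorph0 rmorphN rmorph1 mulN1r addNr.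
- exact: mulrA.
- by rewrite rmorph1 mul1r.
- exact: mulrDl.
- exact: mulrDr.
- exact: rmorphD.
- exact: rmorphM.
Qed.

Lemma palg_universal :
  exists f : {rmorphism palg -> A},
    [/\ forall k, f (k *: (1 : palg)) = phi k, forall g, f (pgen g) = h g
      & forall f' : {rmorphism palg -> A},
          (forall k, f' (k *: (1 : palg)) = phi k) -> (forall g, f' (pgen g) = h g) ->
          f' =1 f].
Proof.
pose f (a : palg) := aeval (palg_repr a).
have f_pi p : f (palg_pi p) = aeval p by apply/aeval_aeq/palg_repr_pi.
have fD : zmod_morphism f.
  suff fD a b : f (a + b) = f a + f b.
    by move=> a b; apply/eqP; rewrite eq_sym subr_eq -fD subrK.
  by rewrite -[a]palg_reprK -[b]palg_reprK -palg_piD !f_pi.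
have fM : monoid_morphism f.
  split=> [|a b]; first by rewrite -palg_pi1 f_pi /= rmorph1.
  by rewrite -[a]palg_reprK -[b]palg_reprK -palg_piM !f_pi.
pose fZ := GRing.isZmodMorphism.Build _ _ f fD.
pose fR := GRing.isMonoidMorphism.Build _ _ f fM.
pose F : {rmorphism palg -> A} := HB.pack f fZ fR.
exists F; split=> [k|g|f' f'S f'g a]; rewrite ?[F _]f_pi //.
  by rewrite -palg_piS [LHS]f_pi.
rewrite -[a]palg_reprK [RHS]f_pi.
elim: (palg_repr a) => [g|k|p IHp q IHq|p IHp q IHq].
- exact: f'g.
- by rewrite palg_piS f'S.
- by rewrite palg_piD rmorphD IHp IHq.
- by rewrite palg_piM rmorphM IHp IHq.
Qed.

End UniversalProperty.

Definition gen_subalg (S : palg -> Prop) : {pred palg} :=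
  fun a => `[< forall B : {pred palg}, subring_closed B -> submod_closed B ->
                 (forall s, S s -> s \in B) -> a \in B >].

Section GeneratedSubalgebra.

Variable S : palg -> Prop.

Lemma gen_subalgP a :
  reflect (forall B : {pred palg}, subring_closed B -> submod_closed B ->
             (forall s, S s -> s \in B) -> a \in B)
          (a \in gen_subalg S).
Proof. exact: asboolP. Qed.

Lemma mem_gen_subalg s : S s -> s \in gen_subalg S.
Proof. by move=> Ss; apply/gen_subalgP => B _ _; apply. Qed.

Lemma gen_subalg_subring_closed : subring_closed (gen_subalg S).
Proof.
split=> [|a b /gen_subalgP Sa /gen_subalgP Sb
         |a b /gen_subalgP Sa /gen_subalgP Sb]; apply/gen_subalgP=> B Br Bm BS;
  case: (Br) => B1 BB BM //; [apply: BB | apply: BM];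
  by [apply: Sa | apply: Sb].
Qed.

Lemma gen_subalg_submod_closed : submod_closed (gen_subalg S).
Proof.
split=> [|k a b /gen_subalgP Sa /gen_subalgP Sb]; apply/gen_subalgP=> B Br Bm BS;
  case: (Bm) => B0 BD //; apply: BD; by [apply: Sa | apply: Sb].
Qed.

HB.instance Definition _ := GRing.isSubringClosed.Build palg (gen_subalg S)
  gen_subalg_subring_closed.
HB.instance Definition _ := GRing.isScaleClosed.Build K palg (gen_subalg S)
  (GRing.subsemimod_closedZ
     (GRing.submod_closed_semi gen_subalg_submod_closed)).

Record subalg := Subalg {
  subalg_val :> palg;
  subalg_valP : subalg_val \in gen_subalg S
}.

HB.instance Definition _ := [isSub for subalg_val].
HB.instance Definition _ := [Choice of subalg by <:].
HB.instance Definition _ := GRing.SubChoice_isSubPzRing.Build palg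
  (gen_subalg S) subalg gen_subalg_subring_closed.
HB.instance Definition _ := GRing.SubZmodule_isSubLmodule.Build K palg
  (gen_subalg S) subalg
  (GRing.submod_closed_semi gen_subalg_submod_closed).

End GeneratedSubalgebra.

End PresentedAlgebra.

(* In both algebras the relations of the group S_n read sigma * tau =
   sigma \o tau, as required by sigma x_i = x_(sigma i) sigma.  MathComp
   multiplies permutations in the opposite order, (s * t)%g i = t (s i), hence
   the swapped factors below.  Indices run over 0, ..., n - 1. *)

Section RationalDoubleAffine.

Variables (K : fieldType) (n : nat) (u : K).

Variant rdahc_gen := RX of 'I_n | RY of 'I_n | RC of 'I_n | RS of 'S_n.

Local Notation x i := (AGen (RX i)).
Local Notation y i := (AGen (RY i)).
Local Notation c i := (AGen (RC i)).
Local Notation S s := (AGen (RS s)).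

Variant rdahc_rel : aterm K rdahc_gen -> aterm K rdahc_gen -> Prop :=
| rdahc_S1 : rdahc_rel (S 1%g) 1
| rdahc_SM s t : rdahc_rel (S s * S t) (S (t * s)%g)
| rdahc_xx i j : rdahc_rel (x i * x j) (x j * x i)
| rdahc_yy i j : rdahc_rel (y i * y j) (y j * y i)
| rdahc_Sx s i : rdahc_rel (S s * x i) (x (s i) * S s)
| rdahc_Sy s i : rdahc_rel (S s * y i) (y (s i) * S s)
| rdahc_Sc s i : rdahc_rel (S s * c i) (c (s i) * S s)
| rdahc_cx i : rdahc_rel (c i * x i) (- (x i * c i))
| rdahc_cy i : rdahc_rel (c i * y i) (y i * c i)
| rdahc_cx_neq i j : i != j -> rdahc_rel (c j * x i) (x i * c j)
| rdahc_cy_neq i j : i != j -> rdahc_rel (c j * y i) (y i * c j)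
| rdahc_c2 i : rdahc_rel (c i * c i) 1
| rdahc_cc i j : i != j -> rdahc_rel (c i * c j) (- (c j * c i))
| rdahc_yx_neq i j : i != j ->
    rdahc_rel (y j * x i - x i * y j)
              (u *: ((1 + c j * c i) * S (tperm i j)))
| rdahc_yx i :
    rdahc_rel (y i * x i - x i * y i)
              (- (u *: \big[@AAdd K rdahc_gen/0%A]_(k < n | k != i)
                  ((1 + c k * c i) * S (tperm k i))%A)).

Definition rdahc := palg rdahc_rel.
HB.instance Definition _ := Choice.on rdahc.
HB.instance Definition _ := GRing.PzRing.on rdahc.
HB.instance Definition _ := GRing.Lmodule.on rdahc.

Definition rdahc_x (i : 'I_n) : rdahc := pgen rdahc_rel (RX i).
Definition rdahc_y (i : 'I_n) : rdahc := pgen rdahc_rel (RY i).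
Definition rdahc_c (i : 'I_n) : rdahc := pgen rdahc_rel (RC i).
Definition rdahc_S (s : 'S_n) : rdahc := pgen rdahc_rel (RS s).

Definition rdahc_M (i : 'I_n) : rdahc :=
  \sum_(k < n | (k < i)%N)
    (1 - rdahc_c i * rdahc_c k) * rdahc_S (tperm k i).

Definition rdahc_z (i : 'I_n) : rdahc :=
  u^-1 *: (rdahc_y i * rdahc_x i) + rdahc_M i.

Variant shifted_gens (alpha : K) : rdahc -> Prop :=
| shifted_gens_c i : shifted_gens alpha (rdahc_c i)
| shifted_gens_z i : shifted_gens alpha (alpha *: rdahc_x i + rdahc_z i)
| shifted_gens_S s : shifted_gens alpha (rdahc_S s).

End RationalDoubleAffine.

Section DegenerateAffine.

Variables (K : fieldType) (n : nat).

Variant dahc_gen := DA of 'I_n | DC of 'I_n | DS of 'S_n.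

Local Notation a i := (AGen (DA i)).
Local Notation c i := (AGen (DC i)).
Local Notation S s := (AGen (DS s)).

(* The simple transposition s_i is [tperm i i'] with i' = i.+1, so a simple
   transposition is available exactly when i.+1 < n. *)
Variant dahc_rel : aterm K dahc_gen -> aterm K dahc_gen -> Prop :=
| dahc_S1 : dahc_rel (S 1%g) 1
| dahc_SM s t : dahc_rel (S s * S t) (S (t * s)%g)
| dahc_Sc s i : dahc_rel (S s * c i) (c (s i) * S s)
| dahc_c2 i : dahc_rel (c i * c i) 1
| dahc_cc i j : i != j -> dahc_rel (c i * c j) (- (c j * c i))
| dahc_aS_neq (i i' j : 'I_n) : i' = i.+1 :> nat -> j != i -> j != i' ->
    dahc_rel (a j * S (tperm i i')) (S (tperm i i') * a j)
| dahc_aS (i i' : 'I_n) : i' = i.+1 :> nat ->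
    dahc_rel (a i' * S (tperm i i') - S (tperm i i') * a i)
             (1 - c i' * c i)
| dahc_ca i : dahc_rel (c i * a i) (- (a i * c i))
| dahc_aa i j : dahc_rel (a i * a j) (a j * a i)
| dahc_ca_neq i j : i != j -> dahc_rel (c j * a i) (a i * c j).

Definition dahc := palg dahc_rel.
HB.instance Definition _ := Choice.on dahc.
HB.instance Definition _ := GRing.PzRing.on dahc.
HB.instance Definition _ := GRing.Lmodule.on dahc.

End DegenerateAffine.

(* Main.v *)
Require Import Defs.
From HB Require Import structures.
From mathcomp Require Import all_boot all_fingroup all_algebra.
From mathcomp Require Import ring boolp functions reals.
From mathcomp.real_closed Require Import complex.

Set Implicit Arguments.
Unset Strict Implicit.
Unset Printing Implicit Defensive.

Import GRing.Theory Num.Theory.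
Local Open Scope ring_scope.

(** Put v_i = u^-1 y_i and b_i = alpha x_i + z_i, so that
    b_i = alpha x_i + v_i x_i + M_i.

    The map a_i |-> b_i, c_i |-> c_i, s |-> s respects the relations of the
    degenerate affine algebra ([shifted_dahc]).  Only [b_i, b_j] = 0 needs an
    idea.  For j < i the element b_i commutes with every generator c_k and s
    whose indices are all smaller than i, hence with M_j.  Moving b_i across
    x_j and across v_j produces the corrections of [shifted_X] and [shifted_Y],
    and in b_i (alpha x_j + v_j x_j) these corrections cancel.  The map is onto
    the subalgebra because it hits all of its generators.

    Injectivity is a Poincare-Birkhoff-Witt phenomenon.  Moving the a_i to the
    left shows that the degenerate affine algebra is spanned by the products
    a_l g, with a_l a word in the a_i and g in the algebra generated by the c_i
    and S_n ([spanned_all]).  So it is enough to find a representation of the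
    double affine algebra in which the operators b_l g are visibly independent.
    Such a representation is given by Dunkl operators ([dunkl_rdahc]).  On
    functions of a point x with nonzero coordinates of distinct squares, x_i is
    multiplication by the i-th coordinate, and

      v_i = E_i - alpha + sum_(k != i) R_ik s_ik,
      R_ik = 1 / (x_i - x_k) - 1 / (x_i + x_k) c_i c_k,

    where the E_i are free commuting parameters, permuted by S_n.  The Dunkl
    operators commute because R solves an associative Yang-Baxter equation
    ([Rop_YB]).  The constant - alpha is allowed because v_i |-> v_i - alpha
    preserves all relations; it is chosen to turn b_i into
    E_i x_i + (terms free of E), whatever alpha is.  Applied to a vacuum vector,
    a word of length d in the b_i has a single term of degree d in E, namely
    the monomial E_l times the product x_l of the corresponding coordinates,
    which is nonzero ([word_top]).  The coefficients g can therefore be read off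
    from the top degree downwards ([comb_eq0]).  The functions take their values in the algebra generated by
    the c_i and S_n itself, acting on the left, so that each g is recovered as
    an element and no basis of that algebra is needed. *)

(** * Identities in abelian groups *)

(** Expressions over the atoms of an environment: two of them agree in every
    abelian group as soon as each atom has the same integer coefficient in
    both.  This decides the additive bookkeeping left after noncommutative
    products have been expanded. *)
Inductive zexpr := ZVar of nat | ZZero | ZAdd of zexpr & zexpr | ZOpp of zexpr.

Fixpoint zeval (V : zmodType) (env : seq V) e : V :=
  match e with
  | ZVar i => env`_i
  | ZZero => 0
  | ZAdd e f => zeval env e + zeval env f
  | ZOpp e => - zeval env e
  end.

Fixpoint zcoef e (i : nat) : int :=
  match e with
  | ZVar j => (i == j)%:Z
  | ZZero => 0
  | ZAdd e f => zcoef e i + zcoef f i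
  | ZOpp e => - zcoef e i
  end.

Lemma zevalE (V : zmodType) (env : seq V) e :
  zeval env e = \sum_(i < size env) env`_i *~ zcoef e i.
Proof.
elim: e => [j||e IHe f IHf|e IHe] /=.
- have [lt_j|ge_j] := ltnP j (size env).
    rewrite (bigD1 (Ordinal lt_j)) //= eqxx big1 ?addr0 // => i.
    by rewrite -val_eqE /= => /negPf ->.
  rewrite nth_default // big1 // => i _.
  by rewrite ltn_eqF // (leq_trans (ltn_ord i)).
- by rewrite big1.
- by rewrite IHe IHf -big_split; apply: eq_bigr => i _; rewrite mulrzDr.
- by rewrite IHe -sumrN; apply: eq_bigr => i _; rewrite mulrNz.
Qed.

Lemma zeval_eq (V : zmodType) (env : seq V) e f :
  all (fun i => zcoef e i == zcoef f i) (iota 0 (size env)) ->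
  zeval env e = zeval env f.
Proof.
move/allP=> ef; rewrite !zevalE; apply: eq_bigr => i _; congr (_ *~ _).
by apply/eqP/ef; rewrite mem_iota add0n ltn_ord.
Qed.

(* Atoms are compared up to unification, since the same product may be typed
   through different paths of the algebraic hierarchy. *)
Ltac zadd x env :=
  match env with
  | context [?y :: _] => let _ := match goal with _ => unify x y end in env
  | _ => constr:(x :: env)
  end.
Ltac zatoms env t :=
  lazymatch t with
  | 0%R => env
  | (?a + ?b)%R => let env := zatoms env a in zatoms env b
  | (- ?a)%R => zatoms env a
  | _ => zadd t env
  end.
Ltac zindex x env :=
  match env with
  | ?y :: _ => let _ := match goal with _ => unify x y end in constr:(0%N)
  | _ :: ?e => let i := zindex x e in constr:(i.+1)
  end.
Ltac zreify env t :=
  lazymatch t with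
  | 0%R => constr:(ZZero)
  | (?a + ?b)%R =>
    let e := zreify env a in let f := zreify env b in constr:(ZAdd e f)
  | (- ?a)%R => let e := zreify env a in constr:(ZOpp e)
  | _ => let i := zindex t env in constr:(ZVar i)
  end.
Ltac abel :=
  lazymatch goal with
  | |- @eq ?T ?a ?b =>
    let env := zatoms (@nil T) a in let env := zatoms env b in
    let e := zreify env a in let f := zreify env b in
    refine (@zeval_eq _ env e f _); vm_compute; reflexivity
  end.

(** * Presented algebras *)

Section Presented.
Variables (K : fieldType) (G : Type) (rel : aterm K G -> aterm K G -> Prop).

Lemma palg_piZ k p : palg_pi rel (k *: p)%A = k *: palg_pi rel p.
Proof. by rewrite palg_piM palg_piS -palg_scalerAl mul1r. Qed.

Lemma palg_piN p : palg_pi rel (- p)%A = - palg_pi rel p.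
Proof. by rewrite palg_piZ scaleN1r. Qed.

Lemma palg_piB p q : palg_pi rel (p - q)%A = palg_pi rel p - palg_pi rel q.
Proof. by rewrite palg_piD palg_piN. Qed.

Lemma palg_pi_sum (I : Type) (r : seq I) (P : pred I) (F : I -> aterm K G) :
  palg_pi rel (\big[@AAdd K G/0%A]_(i <- r | P i) F i) =
  \sum_(i <- r | P i) palg_pi rel (F i).
Proof. exact: (big_morph _ (@palg_piD _ _ rel) (@palg_pi0 _ _ rel)). Qed.

Lemma palg_ind (P : palg rel -> Prop) :
    (forall g, P (pgen rel g)) -> (forall k, P (k *: (1 : palg rel))) ->
    (forall a b, P a -> P b -> P (a + b)) ->
    (forall a b, P a -> P b -> P (a * b)) -> forall a, P a.
Proof.
move=> Pg Pk PD PM a; rewrite -[a]palg_reprK.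
elim: (palg_repr a) => [g|k|p IHp q IHq|p IHp q IHq]; first exact: Pg.
- by rewrite palg_piS.
- by rewrite palg_piD; apply: PD.
- by rewrite palg_piM; apply: PM.
Qed.
End Presented.

(** * The relations in an arbitrary ring *)

(** The relations are stated for families of elements of any ring: the same
    computations are then used in the presented algebras, in the subalgebra and
    in the ring of operators. *)
Record sergeev_relations (A : pzRingType) (n : nat) (C : 'I_n -> A)
    (W : 'S_n -> A) : Prop := SergeevRelations {
  relW1 : W 1%g = 1;
  relWM (s t : 'S_n) : W s * W t = W (t * s)%g;
  relWC (s : 'S_n) (i : 'I_n) : W s * C i = C (s i) * W s;
  relC2 (i : 'I_n) : C i * C i = 1;
  relCC (i j : 'I_n) : i != j -> C i * C j = - (C j * C i)
}.

(** [Y] stands for u^-1 y, which makes the relations independent of u. *)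
Record rdahc_relations (A : pzRingType) (n : nat) (X Y C : 'I_n -> A)
    (W : 'S_n -> A) : Prop := RdahcRelations {
  rdahc_sergeev :> sergeev_relations C W;
  relXX (i j : 'I_n) : X i * X j = X j * X i;
  relYY (i j : 'I_n) : Y i * Y j = Y j * Y i;
  relWX (s : 'S_n) (i : 'I_n) : W s * X i = X (s i) * W s;
  relWY (s : 'S_n) (i : 'I_n) : W s * Y i = Y (s i) * W s;
  relCX (i : 'I_n) : C i * X i = - (X i * C i);
  relCXn (i j : 'I_n) : i != j -> C j * X i = X i * C j;
  relCY (i j : 'I_n) : C j * Y i = Y i * C j;
  relYXn (i j : 'I_n) : i != j ->
    Y j * X i = X i * Y j + (1 + C j * C i) * W (tperm i j);
  relYX (i : 'I_n) : Y i * X i =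
    X i * Y i - \sum_(k < n | k != i) (1 + C k * C i) * W (tperm k i)
}.

Record dahc_relations (A : pzRingType) (n : nat) (B C : 'I_n -> A)
    (W : 'S_n -> A) : Prop := DahcRelations {
  dahc_sergeev :> sergeev_relations C W;
  relBW (i i' j : 'I_n) : i' = i.+1 :> nat -> j != i -> j != i' ->
    B j * W (tperm i i') = W (tperm i i') * B j;
  relBWs (i i' : 'I_n) : i' = i.+1 :> nat ->
    B i' * W (tperm i i') - W (tperm i i') * B i = 1 - C i' * C i;
  relCB (i : 'I_n) : C i * B i = - (B i * C i);
  relBB (i j : 'I_n) : B i * B j = B j * B i;
  relCBn (i j : 'I_n) : i != j -> C j * B i = B i * C j
}.

Lemma tperm_out n (i j k : 'I_n) : k != i -> k != j -> tperm i j k = k.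
Proof. by move=> ki kj; rewrite tpermD // eq_sym. Qed.

Lemma W_tperm (A : pzRingType) n (C : 'I_n -> A) (W : 'S_n -> A)
    (rel : sergeev_relations C W) s (i k : 'I_n) :
  W s * W (tperm i k) = W (tperm (s i) (s k)) * W s.
Proof. by rewrite !(relWM rel) -tpermJ conjgE !mulgA mulgV mul1g. Qed.

(** * The shifted elements satisfy the degenerate affine relations *)

(** The central element [a] plays the role of the scalar alpha. *)
Section Shifted.
Variables (A : pzRingType) (n : nat) (X Y C : 'I_n -> A) (W : 'S_n -> A).
Hypothesis rel : rdahc_relations X Y C W.
Variable a : A.
Hypothesis aC : forall b, a * b = b * a.
Implicit Types (i j k : 'I_n) (s t : 'S_n).

Let aCA b c : b * (a * c) = a * (b * c).
Proof. by rewrite mulrA -aC mulrA. Qed.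

Let WM := relWM rel.
Let WC := relWC rel.
Let C2 := relC2 rel.
Let CC := relCC rel.
Let XX := relXX rel.
Let YY := relYY rel.
Let WX := relWX rel.
Let WY := relWY rel.
Let CX := relCX rel.
Let CXn := relCXn rel.
Let CY := relCY rel.
Let YXn := relYXn rel.

(** The summands of the Jucys-Murphy elements M_i. *)
Definition jm_term i k : A := (1 - C i * C k) * W (tperm k i).
Local Notation J := jm_term.

Lemma W_jm s i k : W s * J i k = J (s i) (s k) * W s.
Proof.
rewrite /J mulrA mulrBr mulr1 mulrA WC -mulrA WC mulrA.
rewrite -[X in X - _]mul1r -mulrBl.
by rewrite -!mulrA (W_tperm rel).
Qed.

Lemma C_CC i j k : i != j -> i != k -> C i * (C j * C k) = C j * C k * C i.
Proof.
move=> ij ik; rewrite mulrA (CC ij) mulNr -(mulrA (C j) (C i)) (CC ik).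
by rewrite mulrN opprK mulrA.
Qed.

Lemma mul1Br (R : pzRingType) (b c : R) : b * (1 - c) = b - b * c.
Proof. by rewrite mulrBr mulr1. Qed.

Lemma mul1Bl (R : pzRingType) (b c : R) : (1 - c) * b = b - c * b.
Proof. by rewrite mulrBl mul1r. Qed.

Lemma C_jm i k : C i * J i k = - (J i k * C i).
Proof.
rewrite /J -[_ * _ * C i]mulrA WC tpermR !mulrA -[RHS]mulNr.
congr (_ * _); rewrite mul1Br mul1Bl opprB mulrA C2 mul1r.
by rewrite -mulrA C2 mulr1.
Qed.

Lemma Ck_jm i k : i != k -> C k * J i k = J i k * C k.
Proof.
move=> ik; rewrite /J -[_ * _ * C k]mulrA WC tpermL !mulrA.
congr (_ * _); rewrite mul1Br mul1Bl (CC ik) mulrN mulNr !opprK.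
by rewrite mulrA C2 mul1r -mulrA C2 mulr1 addrC.
Qed.

Lemma C_jm_out i j k : j != i -> j != k -> C j * J i k = J i k * C j.
Proof.
move=> ji jk; rewrite /J -[_ * _ * C j]mulrA WC tperm_out // !mulrA.
by congr (_ * _); rewrite mul1Br mul1Bl C_CC.
Qed.

Lemma jm_X_out i j k : j != i -> j != k -> J i k * X j = X j * J i k.
Proof.
move=> ji jk; rewrite /J -mulrA WX tperm_out // !mulrA.
congr (_ * _); rewrite mul1Br mul1Bl -mulrA.
by rewrite (CXn jk) [C i * (_ * _)]mulrA (CXn ji) mulrA.
Qed.

Lemma jm_Y i k : J i k * Y k = Y i * J i k.
Proof.
rewrite /J -mulrA WY tpermL !mulrA.
congr (_ * _); rewrite mul1Br mul1Bl -mulrA.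
by rewrite CY [C i * (_ * _)]mulrA CY mulrA.
Qed.

Lemma jm_Y_out i j k : j != i -> j != k -> J i k * Y j = Y j * J i k.
Proof.
move=> ji jk; rewrite /J -mulrA WY tperm_out // !mulrA.
by congr (_ * _); rewrite mul1Br mul1Bl -mulrA CY [C i * (_ * _)]mulrA CY mulrA.
Qed.

Definition shifted i :=
  a * X i + Y i * X i + \sum_(k < n | (k < i)%N) J i k.
Local Notation B := shifted.

Lemma shifted_C i : C i * B i = - (B i * C i).
Proof.
rewrite /B !mulrDl !mulrDr !opprD.
rewrite mulr_suml mulr_sumr -sumrN; congr (_ + _ + _).
- by rewrite aCA CX mulrN mulrA.
- by rewrite mulrA CY -!mulrA CX mulrN.
by apply: eq_bigr => k ki; rewrite C_jm.
Qed.

Lemma shifted_Cn i j : i != j -> C j * B i = B i * C j.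
Proof.
move=> ij; rewrite /B !mulrDl !mulrDr mulr_suml mulr_sumr.
congr (_ + _ + _).
- by rewrite aCA CXn // mulrA.
- by rewrite mulrA CY -!mulrA CXn.
apply: eq_bigr => k ki; have [jk|jk] := eqVneq j k.
  by rewrite jk Ck_jm // neq_ltn ki orbT.
by rewrite C_jm_out // eq_sym.
Qed.

(** The condition on [s] says that it preserves the range k < j of the sum that
    defines M_j; it holds for the simple transpositions not moving j and for
    all permutations of the indices below j. *)
Lemma shifted_S s j : s j = j -> (forall k, (s k < j)%N = (k < j)%N) ->
  B j * W s = W s * B j.
Proof.
move=> sj sk; rewrite /B !mulrDl !mulrDr mulr_suml mulr_sumr.
congr (_ + _ + _).
- by rewrite aCA WX sj mulrA.
- by rewrite mulrA WY -!mulrA WX sj.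
rewrite (reindex_inj (@perm_inj _ s)) /=.
by apply: eq_big => // k _; rewrite W_jm sj.
Qed.

(** Conjugation by s_i turns M_i into M_(i+1) without its term k = i, and that
    term gives the right-hand side. *)
Lemma shifted_S_simple (i i' : 'I_n) : i' = i.+1 :> nat ->
  B i' * W (tperm i i') - W (tperm i i') * B i = 1 - C i' * C i.
Proof.
move=> ii'; rewrite !/B !mulrDl !mulrDr mulr_suml mulr_sumr.
rewrite (bigD1 i) /=; last by rewrite ii'.
rewrite aCA WX tpermL mulrA.
rewrite [W _ * (_ * _)]mulrA WY tpermL -!(mulrA (Y i')) WX tpermL.
have -> : J i' i * W (tperm i i') = 1 - C i' * C i.
  by rewrite /J -mulrA WM tperm2 (relW1 rel) mulr1.
rewrite (eq_bigl (fun k : 'I_n => (k < i)%N)) => [|k]; last first.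
  by rewrite ii' ltnS ltn_neqAle andbC.
have -> : \sum_(k < n | (k < i)%N) W (tperm i i') * J i k =
    \sum_(k < n | (k < i)%N) J i' k * W (tperm i i').
  apply: eq_bigr => k ki; rewrite W_jm tpermL tperm_out //.
    by rewrite neq_ltn ki.
  by apply: contraTneq ki => ->; rewrite ii' ltnNge leqnSn.
by rewrite opprD addrACA subrr add0r addrK.
Qed.

(** The commutator of Y i and X j, for distinct i and j. *)
Definition yx_term i j : A := (1 + C i * C j) * W (tperm i j).
Local Notation P := yx_term.

Lemma CC_Xl i j : i != j -> C i * C j * X i = - (X i * (C i * C j)).
Proof.
move=> ij; rewrite -mulrA (CXn ij) mulrA CX mulNr.
by rewrite -mulrA.
Qed.

Lemma CC_Xr i j : i != j -> C i * C j * X j = - (X j * (C i * C j)).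
Proof.
move=> ij; rewrite -mulrA CX mulrN [C i * (_ * _)]mulrA CXn 1?eq_sym //.
by rewrite -mulrA.
Qed.

(** C i * C j anticommutes with X i and with X j, so moving an X across exchanges
    1 - C i * C j and 1 + C i * C j. *)
Lemma jm_X i j : i != j -> J i j * X j = X i * P i j.
Proof.
move=> ij; rewrite /J /P -mulrA WX tpermL !mulrA tpermC; congr (_ * _).
by rewrite mulrDl mulrDr mul1r mulr1 mulNr CC_Xl // opprK.
Qed.

Lemma yx_X i j : i != j -> P i j * X i = X j * J i j.
Proof.
move=> ij; rewrite /J /P -mulrA WX tpermL !mulrA tpermC; congr (_ * _).
by rewrite mulrDl mulrDr mul1r mulr1 mulrN CC_Xr.
Qed.

Lemma yx_termE i j : i != j -> P i j = J j i.
Proof. by move=> ij; rewrite /P /J CC. Qed.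

(** Of the terms of B i only Y i * X i and the summand k = j of M_i fail to
    commute with X j; their contributions are computed by [yx_X] and [jm_X]. *)
Lemma shifted_X i j : (j < i)%N -> B i * X j = X j * B i + X i * P i j.
Proof.
move=> ji; have ij : i != j by rewrite neq_ltn ji orbT.
have ji' : j != i by rewrite eq_sym.
rewrite /B !mulrDl !mulrDr.
rewrite -mulrA XX -aCA -!addrA; congr (_ + _).
rewrite -(mulrA (Y i)) XX mulrA YXn // mulrDl (mulrA (X j)) -!addrA.
congr (_ + _).
rewrite mulr_suml mulr_sumr (bigD1 j) //= [in RHS](bigD1 j) //= -addrA.
rewrite (eq_bigr (fun k => X j * J i k)) => [|k /andP[ki kj]]; last first.
  by rewrite jm_X_out // eq_sym.
by rewrite addrA [tperm j i]tpermC yx_X // jm_X // addrAC -!addrA.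
Qed.

Lemma shifted_Y i j : (j < i)%N ->
  B i * Y j = Y j * B i - a * P j i - Y j * J i j.
Proof.
move=> ji; have ij : i != j by rewrite neq_ltn ji orbT.
have ji' : j != i by rewrite eq_sym.
have xy : X i * Y j = Y j * X i - P j i by rewrite YXn // /P tpermC addrK.
rewrite /B (bigD1 j) //=; set N := \sum_(k < n | _) _.
have NY : N * Y j = Y j * N.
  rewrite mulr_suml mulr_sumr; apply: eq_bigr => k /andP[ki kj].
  by rewrite jm_Y_out // eq_sym.
rewrite !mulrDl !mulrDr NY jm_Y -(mulrA a) xy mulrBr -(mulrA (Y i)) xy mulrBr.
by rewrite (mulrA (Y i) (Y j)) YY -(mulrA (Y j)) aCA (yx_termE ji'); abel.
Qed.

(** Write B j = (a + Y j) * X j + M_j.  After M_j is dealt with, the correction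
    X i * P i j of [shifted_X], multiplied by a + Y j, cancels the corrections
    of [shifted_Y], multiplied by X j. *)
Lemma shifted_comm i j : B i * B j = B j * B i.
Proof.
wlog ji : i j / (j < i)%N => [H|].
  by case: (ltngtP i j) => [/H|/H|/val_inj ->].
have ij : i != j by rewrite neq_ltn ji orbT.
have ji' : j != i by rewrite eq_sym.
(* B i commutes with C j, C k and with the transposition of k and j, because
   both indices are below i. *)
have Mj : B i * (\sum_(k < n | (k < j)%N) J j k) =
          (\sum_(k < n | (k < j)%N) J j k) * B i.
  rewrite mulr_suml mulr_sumr; apply: eq_bigr => k kj.
  have ki : (k < i)%N by apply: ltn_trans ji.
  have ik : i != k by rewrite neq_ltn ki orbT.
  rewrite /J -mulrA -shifted_S; first last.
  - by move=> l; case: tpermP => [->|->|]; rewrite ?ki ?ji.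
  - by rewrite tperm_out.
  rewrite !mulrA mul1Br mul1Bl; congr ((_ - _) * _).
  by rewrite mulrA -!shifted_Cn // -mulrA -shifted_Cn // mulrA.
(* B i is generalized: it must not be unfolded by the expansions below. *)
rewrite {2 3}/B; move: (shifted_X ji) (shifted_Y ji) Mj.
move: (B i) (\sum_(k < n | _) _) => b M Xb Yb Mb.
rewrite mulrDl !mulrDr Mb; congr (_ + _).
rewrite mulrDl aCA Xb mulrA Yb !mulrBl.
rewrite -!(mulrA (Y j)) Xb -(mulrA a (P j i)) yx_X // jm_X // !mulrDr.
by rewrite yx_termE // (mulrA a (X j)); abel.
Qed.

Lemma shifted_dahc : dahc_relations shifted C W.
Proof.
split.
- exact: rel.
- move=> i i' j ii' ji ji'; apply: shifted_S => [|k]; first by rewrite tperm_out.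
  have ij : (i' < j)%N = (i < j)%N.
    by rewrite ltn_neqAle val_eqE eq_sym ji' ii'.
  by case: tpermP => [->|->|//]; rewrite ij.
- exact: shifted_S_simple.
- exact: shifted_C.
- exact: shifted_comm.
- exact: shifted_Cn.
Qed.
End Shifted.

(** * The relations in the presented algebras *)

Section Presentations.
Variables (K : fieldType) (n : nat) (u : K).
Hypothesis u_neq0 : u != 0.

Let piE := (palg_piM, palg_piD, palg_piN, palg_pi1, palg_piZ).
Let pirel := (fun p q => @palg_pi_rel K _ (@rdahc_rel K n u) p q).

Lemma rdahc_relationsP :
  rdahc_relations (@rdahc_x K n u) (fun i => u^-1 *: rdahc_y u i)
    (@rdahc_c K n u) (@rdahc_S K n u).
Proof.
split; first split.
- by rewrite [LHS](pirel (rdahc_S1 _ _)) piE.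
- by move=> s t; have := pirel (rdahc_SM u s t); rewrite !piE.
- by move=> s i; have := pirel (rdahc_Sc u s i); rewrite !piE.
- by move=> i; have := pirel (rdahc_c2 u i); rewrite !piE.
- by move=> i j ij; have := pirel (rdahc_cc u ij); rewrite piE palg_piN piE.
- by move=> i j; have := pirel (rdahc_xx u i j); rewrite !piE.
- move=> i j; rewrite -!palg_scalerAl -!palg_scalerAr; congr (_ *: (_ *: _)).
  by have := pirel (rdahc_yy u i j); rewrite !piE.
- by move=> s i; have := pirel (rdahc_Sx u s i); rewrite !piE.
- move=> s i; rewrite -palg_scalerAl -palg_scalerAr; congr (_ *: _).
  by have := pirel (rdahc_Sy u s i); rewrite !piE.
- by move=> i; have := pirel (rdahc_cx u i); rewrite piE palg_piN piE.
- by move=> i j ij; have := pirel (rdahc_cx_neq u ij); rewrite !piE.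
- move=> i j; rewrite -palg_scalerAl -palg_scalerAr; congr (_ *: _).
  have [->|ij] := eqVneq i j; first by have := pirel (rdahc_cy u j); rewrite !piE.
  by have := pirel (rdahc_cy_neq u ij); rewrite !piE.
- move=> i j ij; have := pirel (rdahc_yx_neq u ij); rewrite palg_piB palg_piZ !piE.
  move/(congr1 (fun b : rdahc n u => u^-1 *: b)).
  rewrite scalerBr scalerA mulVf // scale1r => /(canRL (subrK _)) e.
  by rewrite -palg_scalerAl -palg_scalerAr addrC.
- move=> i; have := pirel (rdahc_yx u i).
  rewrite palg_piB palg_piN palg_piZ palg_pi_sum !piE.
  move/(congr1 (fun b : rdahc n u => u^-1 *: b)).
  rewrite scalerBr scalerN scalerA mulVf // scale1r => /(canRL (subrK _)) e.
  rewrite -palg_scalerAl -palg_scalerAr addrC e; congr (- _ + _).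
  by apply: eq_bigr => k _; rewrite !piE.
Qed.

Lemma dahc_relationsP :
  dahc_relations (fun i => pgen (@dahc_rel K n) (DA i))
    (fun i => pgen (@dahc_rel K n) (DC i)) (fun s => pgen (@dahc_rel K n) (DS s)).
Proof.
pose pirel' := (fun p q => @palg_pi_rel K _ (@dahc_rel K n) p q).
split; first split.
- by rewrite [LHS](pirel' _ _ (dahc_S1 _ _)) piE.
- by move=> s t; have := pirel' _ _ (dahc_SM K s t); rewrite !piE.
- by move=> s i; have := pirel' _ _ (dahc_Sc K s i); rewrite !piE.
- by move=> i; have := pirel' _ _ (dahc_c2 K i); rewrite !piE.
- by move=> i j ij; have := pirel' _ _ (dahc_cc K ij); rewrite piE palg_piN piE.
- by move=> i i' j e ji ji'; have := pirel' _ _ (dahc_aS_neq K e ji ji'); rewrite !piE.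
- by move=> i i' e; have := pirel' _ _ (dahc_aS K e); rewrite !palg_piB !piE.
- by move=> i; have := pirel' _ _ (dahc_ca K i); rewrite piE palg_piN piE.
- by move=> i j; have := pirel' _ _ (dahc_aa K i j); rewrite !piE.
- by move=> i j ij; have := pirel' _ _ (dahc_ca_neq K ij); rewrite !piE.
Qed.
End Presentations.

(** * Dunkl operators *)

(** The data needed to build Dunkl operators on top of commuting elements X and
    parameters E.  [dunklRX] makes the commutator with X come out right,
    [dunklR_anti] makes E compatible with the reflections, and [dunklR_YB], an
    associative Yang-Baxter equation, makes the Dunkl operators commute. *)
Record dunkl_relations (A : pzRingType) (n : nat) (X E C : 'I_n -> A)
    (W : 'S_n -> A) (R : 'I_n -> 'I_n -> A) : Prop := DunklRelations {
  dunkl_sergeev :> sergeev_relations C W;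
  dunklXX (i j : 'I_n) : X i * X j = X j * X i;
  dunklEE (i j : 'I_n) : E i * E j = E j * E i;
  dunklEX (i j : 'I_n) : E i * X j = X j * E i;
  dunklWX (s : 'S_n) (i : 'I_n) : W s * X i = X (s i) * W s;
  dunklWE (s : 'S_n) (i : 'I_n) : W s * E i = E (s i) * W s;
  dunklCX (i : 'I_n) : C i * X i = - (X i * C i);
  dunklCXn (i j : 'I_n) : i != j -> C j * X i = X i * C j;
  dunklCE (i j : 'I_n) : C j * E i = E i * C j;
  dunklR_anti (i j : 'I_n) : i != j -> R j i = - R i j;
  dunklWR (s : 'S_n) (i j : 'I_n) : W s * R i j = R (s i) (s j) * W s;
  dunklER (k i j : 'I_n) : E k * R i j = R i j * E k;
  dunklCR (i j : 'I_n) : i != j -> C i * R i j = R i j * C j;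
  dunklCRn (i j k : 'I_n) : k != i -> k != j -> C k * R i j = R i j * C k;
  dunklRX (i j : 'I_n) : i != j ->
    R i j * X i = X j * R i j + (1 + C i * C j);
  dunklRXn (i j k : 'I_n) : k != i -> k != j -> R i j * X k = X k * R i j;
  dunklRR (i j k m : 'I_n) : k != i -> k != j -> m != i -> m != j ->
    R i j * R k m = R k m * R i j;
  dunklR_YB (i j m : 'I_n) : i != j -> i != m -> j != m ->
    R i j * R i m + R i m * R j m = R j m * R i j
}.

Section Dunkl.
Variables (A : pzRingType) (n : nat) (X E C : 'I_n -> A) (W : 'S_n -> A).
Variable R : 'I_n -> 'I_n -> A.
Hypothesis rel : dunkl_relations X E C W R.
Implicit Types (i j k m l : 'I_n) (s t : 'S_n).

Let WC := relWC rel.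

Definition dunkl_term i k := R i k * W (tperm i k).
Local Notation Q := dunkl_term.
Definition dunkl i := \sum_(k < n | k != i) Q i k.
Local Notation D := dunkl.

Lemma W_dunkl_term s i k : W s * Q i k = Q (s i) (s k) * W s.
Proof. by rewrite /Q mulrA (dunklWR rel) -!mulrA (W_tperm rel). Qed.

Lemma C_dunkl_term j i k : i != k -> C j * Q i k = Q i k * C j.
Proof.
move=> ik; have ki : k != i by rewrite eq_sym.
rewrite /Q -[RHS]mulrA WC !mulrA; congr (_ * _).
have [->|ji] := eqVneq j i; first by rewrite tpermL (dunklCR rel).
have [->|jk] := eqVneq j k.
  rewrite tpermR -[R i k]opprK -(dunklR_anti rel ik).
  by rewrite mulrN (dunklCR rel) // mulNr.
by rewrite tperm_out // (dunklCRn rel).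
Qed.

Lemma dunkl_term_X_out i k j : j != i -> j != k -> Q i k * X j = X j * Q i k.
Proof.
move=> ji jk; rewrite /Q -mulrA (dunklWX rel) tperm_out // !mulrA.
by rewrite (dunklRXn rel).
Qed.

Lemma dunkl_term_Xr i j : j != i ->
  Q j i * X i = X i * Q j i + (1 + C j * C i) * W (tperm i j).
Proof.
move=> ji; rewrite /Q -mulrA (dunklWX rel) tpermR mulrA (dunklRX rel ji).
by rewrite mulrDl mulrA [tperm i j]tpermC.
Qed.

Lemma dunkl_term_Xl i k : k != i ->
  Q i k * X i = X i * Q i k - (1 + C k * C i) * W (tperm k i).
Proof.
move=> ki; have ik : i != k by rewrite eq_sym.
rewrite /Q -mulrA (dunklWX rel) tpermL mulrA (dunklR_anti rel ki).
by rewrite !mulNr (dunklRX rel ki) mulrDl opprD [tperm i k]tpermC mulrN -!mulrA.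
Qed.

Lemma E_dunkl_term i k j : j != i -> j != k -> E j * Q i k = Q i k * E j.
Proof.
move=> ji jk; rewrite /Q -[RHS]mulrA (dunklWE rel) tperm_out // !mulrA.
by rewrite (dunklER rel).
Qed.

(** The transposition exchanges E i and E j, and R j i = - R i j. *)
Lemma E_dunkl_term_swap i j : i != j -> E i * Q j i + Q i j * E j = 0.
Proof.
move=> ij; rewrite /Q -[X in _ + X]mulrA (dunklWE rel) tpermR mulrA.
rewrite (dunklER rel) (dunklR_anti rel ij) [tperm j i]tpermC mulNr mulNr -!mulrA.
by rewrite addNr.
Qed.

Lemma dunkl_termM i j k m : Q i j * Q k m =
  R i j * R (tperm i j k) (tperm i j m) * (W (tperm i j) * W (tperm k m)).
Proof. by rewrite /Q -mulrA (mulrA (W _)) (dunklWR rel) !mulrA. Qed.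

Lemma dunkl_term_disjoint i j k m : k != i -> k != j -> m != i -> m != j ->
  Q i j * Q k m = Q k m * Q i j.
Proof.
move=> ki kj mi mj; rewrite !dunkl_termM (W_tperm rel) !tperm_out // 1?eq_sym //.
by rewrite (dunklRR rel).
Qed.

Lemma dunkl_term_swap i j : i != j -> Q i j * Q j i = Q j i * Q i j.
Proof.
move=> ij; rewrite !dunkl_termM !tpermL !tpermR [tperm j i]tpermC.
by rewrite (dunklR_anti rel ij) mulrNN.
Qed.

(** The three products carry the same 3-cycle, and their coefficients are those
    of the Yang-Baxter equation for R. *)
Lemma dunkl_term_YB i j m : i != j -> i != m -> j != m ->
  Q i j * Q j m + Q i m * Q j i = Q j m * Q i m.
Proof.
move=> ij im jm; have [ji mi mj] : [/\ j != i, m != i & m != j].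
  by split; rewrite eq_sym.
rewrite !dunkl_termM !tpermL !tpermR !tperm_out //.
have -> : W (tperm j m) * W (tperm i m) = W (tperm i j) * W (tperm j m).
  by rewrite (W_tperm rel) tpermR tperm_out.
have -> : W (tperm i m) * W (tperm j i) = W (tperm i j) * W (tperm j m).
  by rewrite [RHS](W_tperm rel) tpermR tperm_out // [tperm j i]tpermC.
by rewrite -(dunklR_YB rel ij im jm) mulrDl.
Qed.

(** In D i * D j, products of terms with disjoint indices commute, and so do
    the two terms that exchange i and j.  For each third index m there remain
    six products, three on each side; they are matched by [dunkl_term_YB] for
    (i, j, m) and for (j, i, m). *)
Lemma dunklC i j : D i * D j = D j * D i.
Proof.
have [->//|ij] := eqVneq i j.
pose P m := (m != i) && (m != j).
have Di : D i = Q i j + \sum_(m < n | P m) Q i m.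
  by rewrite /D (bigD1 j) //= eq_sym.
have Dj : D j = Q j i + \sum_(m < n | P m) Q j m.
  by rewrite /D (bigD1 i) //=; congr (_ + _); apply: eq_bigl => m; apply: andbC.
rewrite Di Dj; set a := \sum_(m < n | P m) Q i m; set b := \sum_(m < n | P m) Q j m.
have ab : a * b + \sum_(m < n | P m) Q j m * Q i m =
          b * a + \sum_(m < n | P m) Q i m * Q j m.
  rewrite /a mulr_suml mulr_sumr -!big_split /=.
  apply: eq_bigr => m /[dup] Pm /andP[mi mj].
  rewrite /b (bigD1 m) //=; set c := \sum_(l < n | _) _.
  have Qc : Q i m * c = c * Q i m.
    rewrite mulr_suml mulr_sumr; apply: eq_bigr => l /andP[/andP[li lj] lm].
    by rewrite dunkl_term_disjoint // eq_sym.
  by rewrite mulrDl mulrDr Qc; abel.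
have ba : Q i j * b + a * Q j i = \sum_(m < n | P m) Q j m * Q i m.
  rewrite mulr_suml mulr_sumr -big_split /=; apply: eq_bigr => m /andP[mi mj].
  by rewrite dunkl_term_YB // eq_sym.
have ba' : Q j i * a + b * Q i j = \sum_(m < n | P m) Q i m * Q j m.
  rewrite mulr_suml mulr_sumr -big_split /=; apply: eq_bigr => m /andP[mi mj].
  by rewrite dunkl_term_YB // eq_sym.
rewrite !mulrDl !mulrDr (dunkl_term_swap ij) -!addrA; congr (_ + _).
by rewrite !addrA ba ba' addrC ab addrC.
Qed.

Lemma W_dunkl s i : W s * D i = D (s i) * W s.
Proof.
rewrite mulr_suml mulr_sumr [RHS](reindex_inj (@perm_inj _ s)) /=.
by apply: eq_big => [k|k _]; rewrite ?(inj_eq perm_inj) ?W_dunkl_term.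
Qed.

Lemma C_dunkl i j : C j * D i = D i * C j.
Proof.
rewrite mulr_suml mulr_sumr; apply: eq_bigr => k ki.
by rewrite C_dunkl_term // eq_sym.
Qed.

Lemma E_dunkl i j : i != j -> E i * D j = D j * E i + (E i * Q j i - Q j i * E i).
Proof.
move=> ij; rewrite /D (bigD1 i) //=; set b := \sum_(m < n | _) _.
have -> : E i * (Q j i + b) = E i * Q j i + b * E i.
  rewrite mulrDr; congr (_ + _).
  rewrite mulr_suml mulr_sumr; apply: eq_bigr => m /andP[mj mi].
  by rewrite E_dunkl_term // eq_sym.
by rewrite mulrDl; abel.
Qed.

Lemma E_dunkl_sym i j : E i * D j + D i * E j = E j * D i + D j * E i.
Proof.
have [->//|ij] := eqVneq i j.
have ji : j != i by rewrite eq_sym.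
have /(canRL (addrK _)) e1 := E_dunkl_term_swap ij.
have /(canRL (addrK _)) e2 := E_dunkl_term_swap ji.
by rewrite !E_dunkl // e1 e2 !sub0r; abel.
Qed.

Lemma dunkl_rdahc : rdahc_relations X (fun i => E i + D i) C W.
Proof.
split; first exact: rel.
- exact: (dunklXX rel).
- move=> i j; rewrite !mulrDl !mulrDr (dunklEE rel) (dunklC i j) -!addrA.
  congr (_ + _); rewrite !addrA; congr (_ + _).
  by rewrite addrC E_dunkl_sym addrC.
- exact: (dunklWX rel).
- by move=> s i; rewrite mulrDl mulrDr (dunklWE rel) W_dunkl.
- exact: (dunklCX rel).
- exact: (dunklCXn rel).
- by move=> i j; rewrite mulrDl mulrDr (dunklCE rel) C_dunkl.
- move=> i j ij; have ji : j != i by rewrite eq_sym.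
  rewrite mulrDl mulrDr (dunklEX rel) -addrA; congr (_ + _).
  rewrite mulr_suml mulr_sumr (bigD1 i) //= [in RHS](bigD1 i) //= dunkl_term_Xr //.
  rewrite addrAC; congr (_ + _ + _); apply: eq_bigr => k /andP[kj ki].
  by rewrite dunkl_term_X_out // eq_sym.
- move=> i; rewrite mulrDl mulrDr (dunklEX rel) -addrA; congr (_ + _).
  rewrite mulr_suml mulr_sumr -sumrB; apply: eq_bigr => k ki.
  by rewrite dunkl_term_Xl.
Qed.

End Dunkl.

(** * The ring of linear operators *)

Section LinearOperators.
Variables (K : fieldType) (V : lmodType K).

Record linop := LinOp { linop_fun :> V -> V; linop_linear : linear linop_fun }.

HB.instance Definition _ := gen_eqMixin linop.
HB.instance Definition _ := gen_choiceMixin linop.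

Implicit Types f g h : linop.

Lemma linopP f g : (forall v, f v = g v) -> f = g.
Proof.
case: f g => [f lf] [g lg] /= /funext fg; rewrite fg in lf *.
by congr LinOp; apply: Prop_irrelevance.
Qed.

Lemma linopD f v w : f (v + w) = f v + f w.
Proof. by have := linop_linear f 1 v w; rewrite !scale1r. Qed.

Lemma linop0 f : f 0 = 0.
Proof. by apply: (addrI (f 0)); rewrite -linopD !addr0. Qed.

Lemma linopZ f k v : f (k *: v) = k *: f v.
Proof. by have := linop_linear f k v 0; rewrite linop0 !addr0. Qed.

Lemma linop_sum f I (r : seq I) (P : pred I) (F : I -> V) :
  f (\sum_(i <- r | P i) F i) = \sum_(i <- r | P i) f (F i).
Proof. exact: (big_morph _ (linopD f) (linop0 f)). Qed.

Fact linop_zero_linear : linear (fun _ : V => 0 : V).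
Proof. by move=> k v w; rewrite scaler0 addr0. Qed.
Fact linop_one_linear : linear (fun v : V => v).
Proof. by []. Qed.
Fact linop_add_linear f g : linear (fun v => f v + g v).
Proof. by move=> k v w; rewrite !linop_linear scalerDr addrACA. Qed.
Fact linop_opp_linear f : linear (fun v => - f v).
Proof. by move=> k v w; rewrite linop_linear opprD scalerN. Qed.
Fact linop_mul_linear f g : linear (fun v => f (g v)).
Proof. by move=> k v w; rewrite !linop_linear. Qed.

Definition linop_zero := LinOp linop_zero_linear.
Definition linop_one := LinOp linop_one_linear.
Definition linop_add f g := LinOp (linop_add_linear f g).
Definition linop_opp f := LinOp (linop_opp_linear f).
Definition linop_mul f g := LinOp (linop_mul_linear f g).

Fact linop_addA : associative linop_add.
Proof. by move=> f g h; apply: linopP => v /=; rewrite addrA. Qed.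
Fact linop_addC : commutative linop_add.
Proof. by move=> f g; apply: linopP => v /=; rewrite addrC. Qed.
Fact linop_add0 : left_id linop_zero linop_add.
Proof. by move=> f; apply: linopP => v /=; rewrite add0r. Qed.
Fact linop_addN : left_inverse linop_zero linop_opp linop_add.
Proof. by move=> f; apply: linopP => v /=; rewrite addNr. Qed.
HB.instance Definition _ := GRing.isZmodule.Build linop
  linop_addA linop_addC linop_add0 linop_addN.

Fact linop_mulA : associative linop_mul.
Proof. by move=> f g h; apply: linopP. Qed.
Fact linop_mul1l : left_id linop_one linop_mul.
Proof. by move=> f; apply: linopP. Qed.
Fact linop_mul1r : right_id linop_one linop_mul.
Proof. by move=> f; apply: linopP. Qed.
Fact linop_mulDl : left_distributive linop_mul linop_add.
Proof. by move=> f g h; apply: linopP. Qed.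
Fact linop_mulDr : right_distributive linop_mul linop_add.
Proof. by move=> f g h; apply: linopP => v /=; rewrite linopD. Qed.
HB.instance Definition _ := GRing.Zmodule_isPzRing.Build linop
  linop_mulA linop_mul1l linop_mul1r linop_mulDl linop_mulDr.

Lemma linopE_sum I (r : seq I) (P : pred I) (F : I -> linop) v :
  (\sum_(i <- r | P i) F i) v = \sum_(i <- r | P i) F i v.
Proof. by elim/big_rec2: _ => //= i y f _ <-. Qed.

End LinearOperators.

(** * The Sergeev algebra *)

(** The finite part, generated by the c_i and S_n, common to both algebras. *)
Section Sergeev.
Variables (K : fieldType) (n : nat).

Variant sergeev_gen := SC of 'I_n | SS of 'S_n.

Local Notation c i := (AGen (SC i)).
Local Notation S s := (AGen (SS s)).

Variant sergeev_rel : aterm K sergeev_gen -> aterm K sergeev_gen -> Prop :=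
| sergeev_S1 : sergeev_rel (S 1%g) 1
| sergeev_SM s t : sergeev_rel (S s * S t) (S (t * s)%g)
| sergeev_Sc s i : sergeev_rel (S s * c i) (c (s i) * S s)
| sergeev_c2 i : sergeev_rel (c i * c i) 1
| sergeev_cc i j : i != j -> sergeev_rel (c i * c j) (- (c j * c i)).

Definition sergeev := palg sergeev_rel.
HB.instance Definition _ := Choice.on sergeev.
HB.instance Definition _ := GRing.PzRing.on sergeev.
HB.instance Definition _ := GRing.Lmodule.on sergeev.

Definition sergeev_c i : sergeev := pgen sergeev_rel (SC i).
Definition sergeev_S s : sergeev := pgen sergeev_rel (SS s).

Lemma sergeev_relationsP : sergeev_relations sergeev_c sergeev_S.
Proof.
pose piE := (palg_piM, palg_piD, palg_piN, palg_pi1, palg_piZ).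
pose pirel := (fun p q => @palg_pi_rel K _ sergeev_rel p q).
split.
- by rewrite [LHS](pirel _ _ sergeev_S1) piE.
- by move=> s t; have := pirel _ _ (sergeev_SM s t); rewrite !piE.
- by move=> s i; have := pirel _ _ (sergeev_Sc s i); rewrite !piE.
- by move=> i; have := pirel _ _ (sergeev_c2 i); rewrite !piE.
- by move=> i j ij; have := pirel _ _ (sergeev_cc ij); rewrite piE palg_piN piE.
Qed.

End Sergeev.

(** * The Dunkl representation *)

Section Representation.
Variables (K : fieldType) (n : nat).
Implicit Types (i j k m : 'I_n) (s t : 'S_n).

(** The open set on which the denominators x_i - x_j and x_i + x_j do not
    vanish.  It is stable under permutations of the coordinates and under sign
    changes; the latter are needed because c_i anticommutes with x_i. *)
Definition generic (x : {ffun 'I_n -> K}) : bool :=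
  [forall i, x i != 0] &&
  [forall i, forall j, (i != j) ==> (x i ^+ 2 != x j ^+ 2)].

Definition point := {x : {ffun 'I_n -> K} | generic x}.
Implicit Types x : point.

Lemma genericP (x : {ffun 'I_n -> K}) :
  reflect ((forall i, x i != 0) /\
           (forall i j, i != j -> x i ^+ 2 != x j ^+ 2)) (generic x).
Proof.
apply: (iffP andP) => [[/forallP x0 /forallP xx]|[x0 xx]]; split=> //.
- by move=> i j ij; have /forallP/(_ j)/implyP/(_ ij) := xx i.
- exact/forallP.
- by apply/forallP => i; apply/forallP => j; apply/implyP/xx.
Qed.

Lemma point_neq0 x i : val x i != 0.
Proof. by case/genericP: (valP x). Qed.

Lemma point_sub_neq0 x i j : i != j -> val x i - val x j != 0.
Proof.
move=> ij; case/genericP: (valP x) => _ /(_ i j ij).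
by apply: contraNneq => /eqP; rewrite subr_eq0 => /eqP ->.
Qed.

Lemma point_add_neq0 x i j : i != j -> val x i + val x j != 0.
Proof.
move=> ij; case/genericP: (valP x) => _ /(_ i j ij).
by apply: contraNneq => /eqP; rewrite addr_eq0 => /eqP ->; rewrite sqrrN.
Qed.

Fact flip_subproof i x :
  generic [ffun j => if j == i then - val x j else val x j].
Proof.
apply/genericP; case/genericP: (valP x) => x0 xx; split=> [j|j k jk].
  by rewrite ffunE; case: ifP; rewrite ?oppr_eq0.
by rewrite !ffunE; do 2!case: ifP => _; rewrite ?sqrrN xx.
Qed.
Definition flip i x : point := Sub _ (flip_subproof i x).

Fact pperm_subproof s x : generic [ffun j => val x (s j)].
Proof.
apply/genericP; case/genericP: (valP x) => x0 xx; split=> [j|j k jk].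
  by rewrite ffunE.
by rewrite !ffunE xx // (inj_eq perm_inj).
Qed.
Definition pperm s x : point := Sub _ (pperm_subproof s x).

Lemma val_flip i x j : val (flip i x) j = if j == i then - val x j else val x j.
Proof. by rewrite /= ffunE. Qed.
Lemma val_pperm s x j : val (pperm s x) j = val x (s j).
Proof. by rewrite /= ffunE. Qed.

Lemma flipK i : involutive (flip i).
Proof.
by move=> x; apply/val_inj/ffunP => j; rewrite !val_flip; case: eqP; rewrite ?opprK.
Qed.
Lemma flipC i j x : flip i (flip j x) = flip j (flip i x).
Proof.
apply/val_inj/ffunP => k; rewrite !val_flip.
by case: eqP; case: eqP.
Qed.
Lemma pperm1 x : pperm 1 x = x.
Proof. by apply/val_inj/ffunP => j; rewrite val_pperm perm1. Qed.
Lemma ppermM s t x : pperm t (pperm s x) = pperm (t * s) x.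
Proof. by apply/val_inj/ffunP => j; rewrite !val_pperm permM. Qed.
Lemma pperm_flip s i x : flip i (pperm s x) = pperm s (flip (s i) x).
Proof.
apply/val_inj/ffunP => j.
by rewrite val_flip !val_pperm val_flip (inj_eq perm_inj).
Qed.

(** Exponents of Laurent monomials in the parameters E: with exponents in Z
    rather than in N, multiplication by E_i is a mere translation. *)
Definition expo := {ffun 'I_n -> int}.
Definition eperm s (mu : expo) : expo := [ffun j => mu (s j)].
Definition unitexp i : expo := [ffun j => (j == i)%:Z].
Lemma eperm1 mu : eperm 1 mu = mu.
Proof. by apply/ffunP => j; rewrite ffunE perm1. Qed.
Lemma epermM s t mu : eperm t (eperm s mu) = eperm (t * s) mu.
Proof. by apply/ffunP => j; rewrite !ffunE permM. Qed.
Lemma eperm_sub s mu i : eperm s (mu - unitexp (s i)) = eperm s mu - unitexp i.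
Proof. by apply/ffunP => j; rewrite !ffunE (inj_eq perm_inj). Qed.

(** Coefficients of formal Laurent series in E, infinite in all directions, that
    depend on the point x and lie in the Sergeev algebra. *)
Definition vspc := point * expo -> sergeev K n.
HB.instance Definition _ := GRing.Lmodule.copy vspc (point * expo -> sergeev K n).
Implicit Types (v : vspc) (f g : point -> K).

Local Notation c := (@sergeev_c K n).
Local Notation S := (@sergeev_S K n).

Fact mulop_linear f : linear (fun v p => f p.1 *: v p : sergeev K n).
Proof.
by move=> k v w; apply/funext => p; rewrite scalerDr scalerA mulrC -scalerA.
Qed.
Definition mulop f : linop vspc := LinOp (mulop_linear f).

Fact Cop_linear i : linear (fun v p => c i * v (flip i p.1, p.2) : sergeev K n).
Proof.
by move=> k v w; apply/funext => p; rewrite mulrDr -palg_scalerAr.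
Qed.
Definition Cop i : linop vspc := LinOp (Cop_linear i).

Fact Wop_linear s :
  linear (fun v p => S s * v (pperm s p.1, eperm s p.2) : sergeev K n).
Proof.
by move=> k v w; apply/funext => p; rewrite mulrDr -palg_scalerAr.
Qed.
Definition Wop s : linop vspc := LinOp (Wop_linear s).

Fact Eop_linear i : linear (fun v p => v (p.1, p.2 - unitexp i) : sergeev K n).
Proof. by []. Qed.
Definition Eop i : linop vspc := LinOp (Eop_linear i).

Lemma mulopM f g : mulop f * mulop g = mulop (fun x => f x * g x).
Proof. by apply: linopP => v; apply/funext => p /=; rewrite scalerA. Qed.
Lemma mulopD f g : mulop f + mulop g = mulop (fun x => f x + g x).
Proof. by apply: linopP => v; apply/funext => p /=; rewrite scalerDl. Qed.
Lemma mulopN f : - mulop f = mulop (fun x => - f x).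
Proof. by apply: linopP => v; apply/funext => p /=; rewrite scaleNr. Qed.
Lemma mulop1 : mulop (fun=> 1) = 1.
Proof. by apply: linopP => v; apply/funext => p /=; rewrite scale1r. Qed.
Lemma mulop_ext f g : (forall x, f x = g x) -> mulop f = mulop g.
Proof. by move=> fg; congr mulop; apply/funext. Qed.

Lemma mulop_central (k : K) (T : linop vspc) : mulop (fun=> k) * T = T * mulop (fun=> k).
Proof.
apply: linopP => v; apply/funext => p /=.
by rewrite -[RHS]/(T (k *: v) p) linopZ.
Qed.

Lemma Cop_mulop i f : Cop i * mulop f = mulop (fun x => f (flip i x)) * Cop i.
Proof. by apply: linopP => v; apply/funext => p /=; rewrite palg_scalerAr. Qed.
Lemma Wop_mulop s f : Wop s * mulop f = mulop (fun x => f (pperm s x)) * Wop s.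
Proof. by apply: linopP => v; apply/funext => p /=; rewrite palg_scalerAr. Qed.
Lemma Eop_mulop i f : Eop i * mulop f = mulop f * Eop i.
Proof. exact: linopP. Qed.
Lemma Eop_Cop i j : Eop i * Cop j = Cop j * Eop i.
Proof. exact: linopP. Qed.
Lemma EopC i j : Eop i * Eop j = Eop j * Eop i.
Proof. by apply: linopP => v; apply/funext => p /=; rewrite addrAC. Qed.
Lemma Wop_Eop s i : Wop s * Eop i = Eop (s i) * Wop s.
Proof. by apply: linopP => v; apply/funext => p /=; rewrite eperm_sub. Qed.

Lemma op_sergeev_relations : sergeev_relations Cop Wop.
Proof.
have [S1 SM SC C2 CC] := sergeev_relationsP K n.
split.
- apply: linopP => v; apply/funext => -[x mu] /=.
  by rewrite S1 mul1r pperm1 eperm1.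
- move=> s t; apply: linopP => v; apply/funext => -[x mu] /=.
  by rewrite mulrA SM ppermM epermM.
- move=> s i; apply: linopP => v; apply/funext => -[x mu] /=.
  by rewrite !mulrA SC pperm_flip.
- move=> i; apply: linopP => v; apply/funext => -[x mu] /=.
  by rewrite mulrA C2 mul1r flipK.
- move=> i j ij; apply: linopP => v; apply/funext => -[x mu] /=.
  by rewrite -[RHS]/(- (_ * (_ * _))) !mulrA CC // mulNr flipC.
Qed.

Let WC := relWC op_sergeev_relations.
Let C2 := relC2 op_sergeev_relations.
Let CC := relCC op_sergeev_relations.

Local Notation C := Cop.
Local Notation W := Wop.
Local Notation E := Eop.

Definition Xop i : linop vspc := mulop (fun x => val x i).
Local Notation X := Xop.
Definition inv_sub i j x : K := (val x i - val x j)^-1.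
Definition inv_add i j x : K := (val x i + val x j)^-1.
(** The second summand is forced by the first one and by [Cop_Rop]: the sign
    change of x_i exchanges the two denominators. *)
Definition Rop i j : linop vspc :=
  mulop (inv_sub i j) - mulop (inv_add i j) * (C i * C j).
Local Notation R := Rop.

Lemma CCmulop i j f :
  C i * C j * mulop f = mulop (fun x => f (flip i (flip j x))) * (C i * C j).
Proof.
rewrite -mulrA Cop_mulop mulrA Cop_mulop -mulrA; congr (_ * _).
by apply: mulop_ext => x; rewrite flipC.
Qed.

Lemma val_flipL i x : val (flip i x) i = - val x i.
Proof. by rewrite val_flip eqxx. Qed.
Lemma val_flipD i j x : i != j -> val (flip i x) j = val x j.
Proof. by move=> ij; rewrite val_flip eq_sym (negPf ij). Qed.

Lemma inv_sub_flipl i j x : i != j -> inv_sub i j (flip i x) = - inv_add i j x.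
Proof. by move=> ij; rewrite /inv_sub /inv_add val_flipL val_flipD // -opprD invrN. Qed.
Lemma inv_sub_flipr i j x : i != j -> inv_sub i j (flip j x) = inv_add i j x.
Proof.
move=> ij; rewrite /inv_sub /inv_add val_flipL.
by rewrite val_flipD 1?eq_sym // opprK.
Qed.
Lemma inv_sub_flipn i j k x : k != i -> k != j -> inv_sub i j (flip k x) = inv_sub i j x.
Proof. by move=> ki kj; rewrite /inv_sub !val_flipD. Qed.
Lemma inv_add_flipl i j x : i != j -> inv_add i j (flip i x) = - inv_sub i j x.
Proof. by move=> ij; rewrite /inv_sub /inv_add val_flipL val_flipD // addrC -opprB invrN. Qed.
Lemma inv_add_flipr i j x : i != j -> inv_add i j (flip j x) = inv_sub i j x.
Proof. by move=> ij; rewrite /inv_sub /inv_add val_flipL val_flipD 1?eq_sym. Qed.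
Lemma inv_add_flipn i j k x : k != i -> k != j -> inv_add i j (flip k x) = inv_add i j x.
Proof. by move=> ki kj; rewrite /inv_add !val_flipD. Qed.
Lemma inv_subC i j x : inv_sub j i x = - inv_sub i j x.
Proof. by rewrite /inv_sub -invrN opprB. Qed.
Lemma inv_addC i j x : inv_add j i x = inv_add i j x.
Proof. by rewrite /inv_add addrC. Qed.

Lemma Rop_anti i j : i != j -> R j i = - R i j.
Proof.
move=> ij; rewrite /R opprB (CC ij) mulrN addrC; congr (_ + _).
  by congr (- (_ * _)); apply: mulop_ext => x; rewrite inv_addC.
by rewrite mulopN; apply: mulop_ext => x; rewrite inv_subC.
Qed.

Lemma Wop_Rop s i j : W s * R i j = R (s i) (s j) * W s.
Proof.
rewrite /R mulrBr mulrBl Wop_mulop mulrA Wop_mulop -!mulrA.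
rewrite (mulrA (W s)) WC -!mulrA WC !mulrA.
by congr (_ * _ - _ * _ * _ * _); apply: mulop_ext => x; rewrite ?/inv_sub ?/inv_add !val_pperm.
Qed.

Lemma Eop_Rop k i j : E k * R i j = R i j * E k.
Proof.
rewrite /R mulrBr mulrBl Eop_mulop mulrA Eop_mulop -!mulrA.
by rewrite (mulrA (E k)) Eop_Cop -!mulrA Eop_Cop.
Qed.

Lemma Cop_Rop i j : i != j -> C i * R i j = R i j * C j.
Proof.
move=> ij; rewrite /R mulrBr mulrBl Cop_mulop mulrA Cop_mulop -!mulrA.
rewrite C2 mulr1 (mulrA (C i) (C i)) C2 mul1r addrC -mulNr mulopN.
by congr (_ * _ + _); [|rewrite -mulNr mulopN; congr (_ * _)];
  apply: mulop_ext => x; rewrite ?inv_sub_flipl ?inv_add_flipl ?opprK.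
Qed.
Lemma Cop_Rop_out i j k : k != i -> k != j -> C k * R i j = R i j * C k.
Proof.
move=> ki kj; rewrite /R mulrBr mulrBl Cop_mulop mulrA Cop_mulop -!mulrA.
rewrite (mulrA (C k)) (CC ki) mulNr -mulrA (CC kj) !mulrN !opprK.
by congr (_ * _ - _ * _); apply: mulop_ext => x; rewrite ?inv_sub_flipn ?inv_add_flipn.
Qed.

Lemma Rop_X i j : i != j -> R i j * X i = X j * R i j + (1 + C i * C j).
Proof.
move=> ij; have ji : j != i by rewrite eq_sym.
have e1 : mulop (inv_sub i j) * X i = X j * mulop (inv_sub i j) + 1.
  rewrite -mulop1 !mulopM mulopD; apply: mulop_ext => x.
  by rewrite /inv_sub; field; rewrite point_sub_neq0.
have e2 : mulop (inv_add i j) * (C i * C j) * X i =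
          X j * (mulop (inv_add i j) * (C i * C j)) - C i * C j.
  rewrite -mulrA CCmulop !mulrA !mulopM -!mulrA -mulN1r -mulop1 mulopN.
  rewrite -mulrDl mulopD; congr (_ * _); apply: mulop_ext => x.
  by rewrite val_flipL val_flipD // /inv_add; field; rewrite point_add_neq0.
by rewrite /R mulrBl mulrBr e1 e2 opprB [C i * C j - _]addrC addrACA.
Qed.

Lemma Rop_X_out i j k : k != i -> k != j -> R i j * X k = X k * R i j.
Proof.
move=> ki kj; rewrite /R mulrBr mulrBl -(mulrA _ _ (X k)) CCmulop !mulrA !mulopM.
congr (_ - _ * _ * _); apply: mulop_ext => x; first by rewrite mulrC.
by rewrite !val_flipD 1?eq_sym // mulrC.
Qed.

Lemma Rop_disjoint i j k m : k != i -> k != j -> m != i -> m != j ->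
  R i j * R k m = R k m * R i j.
Proof.
move=> ki kj mi mj; have Rf f : (forall x, f (flip i (flip j x)) = f x) ->
    R i j * mulop f = mulop f * R i j.
  move=> fij; rewrite /R mulrBr mulrBl -mulrA CCmulop !mulrA !mulopM.
  by congr (_ - _ * _ * _); apply: mulop_ext => x; rewrite ?fij mulrC.
have Ck := Cop_Rop_out ki kj; have Cm := Cop_Rop_out mi mj.
move: (R i j) Rf Ck Cm => r Rf Ck Cm; rewrite /R mulrBr mulrBl; congr (_ - _).
  by apply: Rf => x; rewrite !inv_sub_flipn // eq_sym.
rewrite mulrA Rf => [|x]; last by rewrite !inv_add_flipn // eq_sym.
by rewrite -!mulrA; congr (_ * _); rewrite (mulrA r) -Ck -!mulrA -Cm.
Qed.

Lemma CCij_im i j m : i != j -> C i * C j * (C i * C m) = - (C j * C m).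
Proof.
by move=> ij; rewrite mulrA (CC ij) mulNr -(mulrA (C j)) C2 mulr1 mulNr.
Qed.
Lemma CCim_jm i j m : j != m -> C i * C m * (C j * C m) = - (C i * C j).
Proof.
by move=> jm; rewrite (CC jm) mulrN -mulrA (mulrA (C m)) C2 mul1r.
Qed.
Lemma CCjm_ij i j m : i != j -> i != m -> j != m ->
  C j * C m * (C i * C j) = - (C i * C m).
Proof.
move=> ij im jm; rewrite (CC ij) mulrN -mulrA (mulrA (C m)) (CC (i:=m)) 1?eq_sym //.
by rewrite mulNr mulrN opprK !mulrA C2 mul1r (CC im) opprK.
Qed.

Lemma Rop_mul i j k m : R i j * R k m =
  mulop (fun x => inv_sub i j x * inv_sub k m x)
  - mulop (fun x => inv_sub i j x * inv_add k m x) * (C k * C m)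
  - mulop (fun x => inv_add i j x * inv_sub k m (flip i (flip j x))) *
    (C i * C j)
  + mulop (fun x => inv_add i j x * inv_add k m (flip i (flip j x))) *
    (C i * C j * (C k * C m)).
Proof.
have expand (A : pzRingType) (a b c d p q : A) :
    (a - b * p) * (c - d * q) = a * c - a * d * q - b * (p * c) + b * (p * d) * q.
  by rewrite mulrBl !mulrBr !mulrA; abel.
rewrite /R expand !CCmulop (mulrA _ (mulop _) (C i * C j)).
by rewrite (mulrA _ (mulop _) (C i * C j)) -(mulrA _ (C i * C j)) !mulopM.
Qed.

(** Each product is expanded on 1, C i * C j, C i * C m and C j * C m; sign
    changes turn the coefficients of the right-hand factor into one another.
    The four resulting identities are partial fraction decompositions. *)
Lemma Rop_YB i j m : i != j -> i != m -> j != m ->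
  R i j * R i m + R i m * R j m = R j m * R i j.
Proof.
move=> ij im jm; have [ji mi mj] : [/\ j != i, m != i & m != j].
  by split; rewrite eq_sym.
pose al := inv_sub; pose be := inv_add.
pose M f g := mulop (fun x => f x * g x).
have e1 : M (al j m) (al i j) = M (al i j) (al i m) + M (al i m) (al j m).
  rewrite mulopD; apply: mulop_ext => x; rewrite /al /inv_sub.
  by field; rewrite !point_sub_neq0.
have eij : M (al j m) (be i j) = M (be i m) (al j m) - M (be i j) (be i m).
  rewrite mulopN mulopD; apply: mulop_ext => x.
  rewrite /al /be /inv_sub /inv_add.
  by field; rewrite point_sub_neq0 // !point_add_neq0.
have eim : M (be j m) (al i j) = M (al i j) (be i m) + M (be i m) (be j m).
  rewrite mulopD; apply: mulop_ext => x.
  rewrite /al /be /inv_sub /inv_add.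
  by field; rewrite point_sub_neq0 // !point_add_neq0.
have ejm : M (be j m) (be i j) = M (al i m) (be j m) - M (be i j) (al i m).
  rewrite mulopN mulopD; apply: mulop_ext => x.
  rewrite /al /be /inv_sub /inv_add.
  by field; rewrite point_sub_neq0 // !point_add_neq0.
have Rijm : R i j * R i m =
      M (al i j) (al i m) - M (al i j) (be i m) * (C i * C m)
      + M (be i j) (be i m) * (C i * C j) + M (be i j) (al i m) * (C j * C m).
  rewrite Rop_mul CCij_im // mulrN -!mulNr !mulopN.
  congr (_ + _ + _ * _ + _ * _); apply: mulop_ext => x.
    by rewrite flipC inv_sub_flipn // inv_sub_flipl // mulrN opprK.
  by rewrite flipC inv_add_flipn // inv_add_flipl // mulrN opprK.
have Rimj : R i m * R j m =
      M (al i m) (al j m) - M (al i m) (be j m) * (C j * C m)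
      - M (be i m) (be j m) * (C i * C m) - M (be i m) (al j m) * (C i * C j).
  rewrite Rop_mul CCim_jm // mulrN -!mulNr !mulopN.
  congr (_ + _ + _ * _ + _ * _); apply: mulop_ext => x.
    by rewrite inv_sub_flipn // inv_sub_flipr.
  by rewrite inv_add_flipn // inv_add_flipr.
have Rjmi : R j m * R i j =
      M (al j m) (al i j) - M (al j m) (be i j) * (C i * C j)
      - M (be j m) (be i j) * (C j * C m) - M (be j m) (al i j) * (C i * C m).
  rewrite Rop_mul CCjm_ij // mulrN -!mulNr !mulopN.
  congr (_ + _ + _ * _ + _ * _); apply: mulop_ext => x.
    by rewrite flipC inv_sub_flipn // inv_sub_flipr.
  by rewrite flipC inv_add_flipn // inv_add_flipr.
rewrite Rijm Rimj Rjmi e1 eij eim ejm.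
have alg (A : pzRingType) (a b d e f g h l p q r : A) :
    a - b * p + d * q + e * r + (f - g * r - h * p - l * q) =
    a + f - (l - d) * q - (g - e) * r - (b + h) * p.
  by rewrite !mulrBl mulrDl; abel.
exact: alg.
Qed.

(** The constant [b] may be subtracted from the parameters because it is central
    and invariant under S_n. *)
Lemma op_dunkl_relations (b : K) :
  dunkl_relations X (fun i => E i - mulop (fun=> b)) C W R.
Proof.
have bC T := esym (mulop_central b T).
have shiftC (A : pzRingType) (e f d : A) : e * f = f * e -> e * d = d * e ->
    f * d = d * f -> (e - d) * (f - d) = (f - d) * (e - d).
  by move=> ef ed fd; rewrite !mulrBl !mulrBr ef ed fd; abel.
have shift1 (A : pzRingType) (e d f : A) : e * f = f * e -> f * d = d * f ->
    (e - d) * f = f * (e - d).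
  by move=> ef fd; rewrite mulrBl mulrBr ef fd.
split.
- exact: op_sergeev_relations.
- by move=> i j; rewrite /X !mulopM; apply: mulop_ext => x; rewrite mulrC.
- by move=> i j; exact: (shiftC _ _ _ _ (EopC i j) (bC _) (bC _)).
- by move=> i j; rewrite mulrBl mulrBr bC Eop_mulop.
- by move=> s i; rewrite Wop_mulop; congr (_ * _); apply: mulop_ext => x; rewrite val_pperm.
- by move=> s i; rewrite mulrBl mulrBr bC Wop_Eop.
- move=> i; rewrite /X Cop_mulop -mulNr mulopN; congr (_ * _).
  by apply: mulop_ext => x; rewrite val_flipL.
- move=> i j ij; rewrite /X Cop_mulop; congr (_ * _).
  by apply: mulop_ext => x; rewrite val_flipD // eq_sym.
- by move=> i j; rewrite mulrBl mulrBr bC Eop_Cop.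
- exact: Rop_anti.
- exact: Wop_Rop.
- by move=> k i j; apply: (shift1 _ _ _ _ (Eop_Rop k i j) (bC _)).
- exact: Cop_Rop.
- exact: Cop_Rop_out.
- exact: Rop_X.
- exact: Rop_X_out.
- exact: Rop_disjoint.
- exact: Rop_YB.
Qed.

End Representation.

(** * Homomorphisms out of the presented algebras *)

Lemma rmorphism_of (K A : pzRingType) (phi : K -> A) :
  phi 1 = 1 -> {morph phi : k l / k + l} -> {morph phi : k l / k * l} ->
  exists F : {rmorphism K -> A}, F =1 phi.
Proof.
move=> phi1 phiD phiM.
have phiB : zmod_morphism phi.
  by move=> k l; apply/eqP; rewrite eq_sym subr_eq -phiD subrK.
pose F : {rmorphism K -> A} := HB.pack phi
  (GRing.isZmodMorphism.Build _ _ phi phiB)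
  (GRing.isMonoidMorphism.Build _ _ phi (conj phi1 phiM)).
by exists F.
Qed.

Section UniversalHom.
Variables (K : fieldType) (n : nat) (A : pzRingType) (F : {rmorphism K -> A}).
Hypothesis FC : forall k a, F k * a = a * F k.

Lemma aeval_sum (G : Type) (h : G -> A) I (r : seq I) (P : pred I) (T : I -> aterm K G) :
  aeval F h (\big[@AAdd K G/0%A]_(i <- r | P i) T i) =
  \sum_(i <- r | P i) aeval F h (T i).
Proof. by apply: (big_morph (aeval F h)) => //=; rewrite rmorph0. Qed.

Lemma sergeev_hom (C : 'I_n -> A) (W : 'S_n -> A) : sergeev_relations C W ->
  exists f : {rmorphism sergeev K n -> A},
    [/\ forall k, f (k *: (1 : sergeev K n)) = F k,
        forall i, f (sergeev_c K i) = C i & forall s, f (sergeev_S K s) = W s].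
Proof.
move=> rel.
pose h g := match g with SC i => C i | SS s => W s end.
have hrel p q : sergeev_rel p q -> aeval F h p = aeval F h q.
  case=> /= [|s t|s i|i|i j ij]; rewrite ?rmorphN ?rmorph1 ?mulN1r.
  - exact: relW1 rel.
  - exact: relWM rel _ _.
  - exact: relWC rel _ _.
  - exact: relC2 rel _.
  - exact: relCC rel _ _ ij.
have [f [fk fg _]] := palg_universal FC hrel.
by exists f; split=> // *; rewrite fg.
Qed.

Lemma dahc_hom (B C : 'I_n -> A) (W : 'S_n -> A) : dahc_relations B C W ->
  exists f : {rmorphism dahc K n -> A},
    [/\ forall k, f (k *: (1 : dahc K n)) = F k,
        forall i, f (pgen (@dahc_rel K n) (DA i)) = B i,
        forall i, f (pgen (@dahc_rel K n) (DC i)) = C i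
      & forall s, f (pgen (@dahc_rel K n) (DS s)) = W s].
Proof.
move=> rel.
pose h g := match g with DA i => B i | DC i => C i | DS s => W s end.
have hrel p q : dahc_rel p q -> aeval F h p = aeval F h q.
  case=> /= [|s t|s i|i|i j ij|i i' j e ij ij'|i i' e|i|i j|i j ij];
    rewrite ?rmorphN ?rmorph1 ?mulN1r.
  - exact: relW1 rel.
  - exact: relWM rel _ _.
  - exact: relWC rel _ _.
  - exact: relC2 rel _.
  - exact: relCC rel _ _ ij.
  - exact: relBW rel _ _ _ e ij ij'.
  - exact: relBWs rel _ _ e.
  - exact: relCB rel _.
  - exact: relBB rel _ _.
  - exact: relCBn rel _ _ ij.
have [f [fk fg _]] := palg_universal FC hrel.
by exists f; split=> // *; rewrite fg.
Qed.

Lemma rdahc_hom (u : K) (X Y C : 'I_n -> A) (W : 'S_n -> A) :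
  rdahc_relations X Y C W ->
  exists f : {rmorphism rdahc n u -> A},
    [/\ forall k, f (k *: (1 : rdahc n u)) = F k,
        (forall i, f (rdahc_x u i) = X i) /\ (forall i, f (rdahc_y u i) = F u * Y i),
        forall i, f (rdahc_c u i) = C i & forall s, f (rdahc_S u s) = W s].
Proof.
move=> rel.
pose h g := match g with
  RX i => X i | RY i => F u * Y i | RC i => C i | RS s => W s end.
have FCA k a b : a * (F k * b) = F k * (a * b) by rewrite mulrA -FC mulrA.
have hrel p q : rdahc_rel u p q -> aeval F h p = aeval F h q.
  case=> /= [|s t|i j|i j|s i|s i|s i|i|i|i j ij|i j ij|i|i j ij|i j ij|i];
    rewrite ?rmorphN ?rmorph1 ?mulN1r ?FCA -?mulrA.
  - exact: relW1 rel.
  - exact: relWM rel _ _.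
  - exact: relXX rel _ _.
  - by rewrite (relYY rel).
  - exact: relWX rel _ _.
  - by rewrite (relWY rel).
  - exact: relWC rel _ _.
  - exact: relCX rel _.
  - by rewrite (relCY rel).
  - exact: relCXn rel _ _ ij.
  - by rewrite (relCY rel).
  - exact: relC2 rel _.
  - exact: relCC rel _ _ ij.
  - by rewrite -mulrBr (relYXn rel ij) addrC addKr.
  - rewrite aeval_sum -mulrBr (relYX rel) addrC addKr mulrN; congr (- (_ * _)).
    by apply: eq_bigr => k _ /=; rewrite rmorph1.
have [f [fk fg _]] := palg_universal FC hrel.
by exists f; do !split=> // *; rewrite fg.
Qed.

End UniversalHom.

(** * Spanning of the degenerate affine algebra *)

(** Every permutation is a product of transpositions, and the transposition of
    i and j + 1 is the conjugate of that of i and j by the simple transposition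
    of j and j + 1. *)
Lemma perm_adjacent_ind (n : nat) (P : 'S_n -> Prop) :
    P 1%g ->
    (forall s (i i' : 'I_n), i' = i.+1 :> nat -> P s -> P (s * tperm i i')%g) ->
  forall s, P s.
Proof.
move=> P1 Padj.
pose Q t := forall s, P s -> P (s * t)%g.
have Qij k (i j : 'I_n) : j = (i + k.+1)%N :> nat -> Q (tperm i j).
  elim: k j => [|k IHk] j ij s Ps.
    by apply: Padj => //; rewrite ij addn1.
  have lt_n : (i + k.+1 < n)%N.
    by apply: leq_ltn_trans (ltn_ord j); rewrite ij leq_add2l.
  pose j' := Ordinal lt_n.
  have jj' : j = j'.+1 :> nat by rewrite ij addnS.
  have -> : tperm i j = (tperm j' j * tperm i j' * tperm j' j)%g.
    have := tpermJ i j' (tperm j' j); rewrite tpermL tpermD => [<-||].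
    - by rewrite conjgE tpermV mulgA.
    - by rewrite -val_eqE /= neq_ltn addnS ltnS leq_addr orbT.
    by rewrite -val_eqE /= ij neq_ltn addnS ltnS leq_addr orbT.
  rewrite !mulgA; apply: (Padj) => //; apply: IHk => //; exact: Padj.
have Qt (i j : 'I_n) : Q (tperm i j).
  case: (ltngtP i j) => [lt|lt|/val_inj ->]; last first.
  - by move=> s; rewrite tperm1 mulg1.
  - by rewrite tpermC; apply: (Qij (i - j).-1); rewrite prednK ?subn_gt0 // subnKC // ltnW.
  by apply: (Qij (j - i).-1); rewrite prednK ?subn_gt0 // subnKC // ltnW.
move=> s; have [ts -> _] := prod_tpermP s.
elim/last_ind: ts => [|ts t IH]; first by rewrite big_nil.
by rewrite big_rcons /=; apply: Qt.
Qed.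

Section Words.
Variables (A : pzRingType) (n : nat) (b : 'I_n -> A).
Implicit Types (i j : 'I_n) (l : seq 'I_n).

Definition word l : A := \prod_(i <- l) b i.

Lemma word_nil : word [::] = 1.
Proof. exact: big_nil. Qed.
Lemma word_cons i l : word (i :: l) = b i * word l.
Proof. exact: big_cons. Qed.

Lemma word_perm l l' :
  (forall i j, b i * b j = b j * b i) -> perm_eq l l' -> word l = word l'.
Proof.
move=> bC; have bw i l1 : word l1 * b i = b i * word l1.
  elim: l1 => [|j l1 IH]; first by rewrite word_nil mul1r mulr1.
  by rewrite word_cons -mulrA IH mulrA bC mulrA.
elim: l l' => [|i l IH] l' ll'.
  by have := perm_size ll'; case: l' ll'.
have il' : i \in l' by rewrite -(perm_mem ll') mem_head.
case/splitPr: il' ll' => l1 l2 ll'.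
have /IH e : perm_eq l (l1 ++ l2).
  by move: ll'; rewrite perm_sym perm_catC /= perm_cons perm_catC perm_sym.
have wc s t : word (s ++ t) = word s * word t by exact: big_cat.
by rewrite word_cons e !wc word_cons !mulrA bw.
Qed.

End Words.

(** The homomorphism [iota] is the natural map from the Sergeev algebra, given
    by its values on generators. *)
Section Spanning.
Variables (K : fieldType) (n : nat).
Local Notation H := (dahc K n).
Local Notation a i := (pgen (@dahc_rel K n) (DA i)).
Local Notation c i := (pgen (@dahc_rel K n) (DC i)).
Local Notation S s := (pgen (@dahc_rel K n) (DS s)).
Variable iota : {rmorphism sergeev K n -> H}.
Hypothesis iotaK : forall k, iota (k *: (1 : sergeev K n)) = k *: (1 : H).
Hypothesis iotac : forall i, iota (sergeev_c K i) = c i.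
Hypothesis iotaS : forall s, iota (sergeev_S K s) = S s.
Implicit Types (l : seq 'I_n) (g : sergeev K n) (w : seq (seq 'I_n * sergeev K n)).

Definition comb w : H := \sum_(t <- w) word (fun i => a i) t.1 * iota t.2.

Definition spanned (p : H) : Prop := exists w, p = comb w.

Let rel := @dahc_relationsP K n.

Lemma spanned_word l g : spanned (word (fun i => a i) l * iota g).
Proof. by exists [:: (l, g)]; rewrite /comb big_seq1. Qed.

Lemma spanned_word1 l : spanned (word (fun i => a i) l).
Proof. by rewrite -[word _ l]mulr1 -(rmorph1 iota); apply: spanned_word. Qed.

Lemma spanned_iota g : spanned (iota g).
Proof. by have := spanned_word [::] g; rewrite word_nil mul1r. Qed.

Lemma spannedD p q : spanned p -> spanned q -> spanned (p + q).
Proof. by move=> [v ->] [w ->]; exists (v ++ w); rewrite /comb big_cat. Qed.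

Lemma spanned0 : spanned 0.
Proof. by exists [::]; rewrite /comb big_nil. Qed.

Lemma spanned_sum I (r : seq I) (F : I -> H) :
  (forall i, spanned (F i)) -> spanned (\sum_(i <- r) F i).
Proof.
by move=> sF; elim/big_rec: _ => [|i p _ sp]; [exact: spanned0 | exact: spannedD].
Qed.

Lemma spannedMr p g : spanned p -> spanned (p * iota g).
Proof.
move=> [w ->]; rewrite /comb mulr_suml; apply: spanned_sum => t.
by rewrite -mulrA -rmorphM; apply: spanned_word.
Qed.

(** Stability under right multiplication by the Sergeev part reduces the left
    multiplications to the case of words in the a_i. *)
Lemma spannedMl q : (forall l, spanned (q * word (fun i => a i) l)) ->
  forall p, spanned p -> spanned (q * p).
Proof.
move=> sq p [w ->]; rewrite /comb mulr_sumr; apply: spanned_sum => t.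
by rewrite mulrA; apply: spannedMr.
Qed.

Lemma spannedN p : spanned p -> spanned (- p).
Proof.
move=> /(spannedMr (- 1)); rewrite rmorphN rmorph1 mulrN mulr1; exact.
Qed.

Lemma spanned_a i p : spanned p -> spanned (a i * p).
Proof.
apply: spannedMl => l; rewrite -[_ * _]mulr1 -(rmorph1 iota).
by have := spanned_word (i :: l) 1; rewrite word_cons.
Qed.

Lemma spanned_c i p : spanned p -> spanned (c i * p).
Proof.
apply: spannedMl => l; elim: l => [|j l IH].
  by rewrite word_nil mulr1 -iotac; apply: spanned_iota.
rewrite word_cons mulrA; have [<-|ij] := eqVneq i j.
  by rewrite (relCB rel) mulNr -mulrA; apply/spannedN/spanned_a.
by rewrite (relCBn rel) 1?eq_sym // -mulrA; apply: spanned_a.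
Qed.

Lemma spanned_cc i j p : spanned p -> spanned ((1 - c i * c j) * p).
Proof.
move=> sp; rewrite mulrBl mul1r -mulrA.
by apply/spannedD/spannedN/spanned_c/spanned_c.
Qed.

(** The transposition moves across the first letter of the word and leaves a term
    1 - c c in front of a shorter word. *)
Lemma spanned_S_adjacent (i i' : 'I_n) p : i' = i.+1 :> nat ->
  spanned p -> spanned (S (tperm i i') * p).
Proof.
move=> ii'; apply: spannedMl; elim=> [|j l IHl].
  by rewrite word_nil mulr1 -iotaS; apply: spanned_iota.
have ai := relBWs rel ii'; have aij := relBW rel ii'.
have tc k := relWC rel (tperm i i') k.
have tt : S (tperm i i') * S (tperm i i') = 1.
  by rewrite (relWM rel) tperm2 (relW1 rel).
have := tc i; have := tc i'; rewrite tpermL tpermR.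
move: (S _) IHl ai aij tt {tc} => t IHl ai aij tt tc' tc.
rewrite word_cons mulrA; have [->|ji] := eqVneq j i.
  have -> : t * a i = a i' * t - (1 - c i' * c i) by rewrite -ai subKr.
  rewrite mulrBl -mulrA; apply: spannedD; first exact: spanned_a.
  exact/spannedN/spanned_cc/spanned_word1.
have [->|ji'] := eqVneq j i'.
  (* the relation for t * a i, conjugated by t *)
  have -> : t * a i' = a i * t + (1 - c i * c i').
    have -> : 1 - c i * c i' = t * (1 - c i' * c i) * t.
      rewrite mulrBr mulrBl mulr1 tt mulrA tc' -!mulrA (mulrA t) tc -mulrA tt.
      by rewrite mulr1.
    rewrite -ai mulrBr mulrBl -!mulrA tt mulr1 mulrA.
    by rewrite -[X in _ = _ + (_ - X)]mulrA (mulrA t t) tt mul1r addrC subrK.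
  rewrite mulrDl -mulrA; apply: spannedD; first exact: spanned_a.
  exact/spanned_cc/spanned_word1.
by rewrite -aij // -mulrA; apply: spanned_a.
Qed.

Lemma spanned_S s p : spanned p -> spanned (S s * p).
Proof.
elim/perm_adjacent_ind: s => [|s i i' ii' IH] in p * => sp.
  by rewrite (relW1 rel) mul1r.
by rewrite -(relWM rel) -mulrA; apply/spanned_S_adjacent/IH.
Qed.

Lemma spanned_all p : spanned p.
Proof.
suff sMl q : forall p, spanned p -> spanned (q * p).
  rewrite -[p]mulr1; apply: sMl.
  by rewrite -(rmorph1 iota); apply: spanned_iota.
elim/palg_ind: q => [[i|i|s]|k|q r IHq IHr|q r IHq IHr] p0 sp.
- exact: spanned_a.
- exact: spanned_c.
- exact: spanned_S.
- rewrite -palg_scalerAl mul1r -[p0]mulr1 palg_scalerAr -iotaK.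
  exact: spannedMr.
- by rewrite mulrDl; apply: spannedD; [apply: IHq|apply: IHr].
- by rewrite -mulrA; apply/IHq/IHr.
Qed.

End Spanning.

(** * Leading terms of words in the Dunkl representation *)

Section Independence.
Variables (K : fieldType) (n : nat).
Local Notation V := (vspc K n).
Local Notation E := (@Eop K n).
Local Notation X := (@Xop K n).
Local Notation C := (@Cop K n).
Local Notation W := (@Wop K n).
Local Notation R := (@Rop K n).
Implicit Types (T U : linop V) (i j : 'I_n) (l : seq 'I_n) (mu : expo n)
  (g : sergeev K n) (v : V) (d : int).

Definition deg mu : int := \sum_(i < n) mu i.

Lemma degB mu nu : deg (mu - nu) = deg mu - deg nu.
Proof. by rewrite /deg -sumrB; apply: eq_bigr => i _; rewrite !ffunE. Qed.

Lemma deg0 : deg 0 = 0.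
Proof. by rewrite /deg big1 // => i _; rewrite ffunE. Qed.

Lemma deg_eperm s mu : deg (eperm s mu) = deg mu.
Proof.
rewrite /deg [RHS](reindex_inj (@perm_inj _ s)).
by apply: eq_bigr => i _; rewrite ffunE.
Qed.

Lemma deg_unitexp i : deg (unitexp i) = 1.
Proof.
rewrite /deg (bigD1 i) //= ffunE eqxx big1 // => j ji.
by rewrite ffunE (negPf ji).
Qed.

Definition vanish d v := forall p, deg p.2 = d -> v p = 0.
(** Such operators act on each homogeneous component in E separately. *)
Definition keeps T := forall d v, vanish d v -> vanish d (T v).

Lemma keepsD T U : keeps T -> keeps U -> keeps (T + U).
Proof.
move=> kT kU d v v0 p pd.
by rewrite -[LHS]/(T v p + U v p) (kT d) // (kU d) // addr0.
Qed.
Lemma keepsN T : keeps T -> keeps (- T).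
Proof. by move=> kT d v v0 p pd; rewrite -[LHS]/(- T v p) (kT d) // oppr0. Qed.
Lemma keepsM T U : keeps T -> keeps U -> keeps (T * U).
Proof. by move=> kT kU d v v0; apply/kT/kU. Qed.
Lemma keeps1 : keeps 1.
Proof. by []. Qed.
Lemma keeps_sum I (r : seq I) (P : pred I) (F : I -> linop V) :
  (forall k : I, P k -> keeps (F k)) -> keeps (\sum_(k <- r | P k) F k).
Proof. by move=> kF; apply: big_ind => //; exact: keepsD. Qed.
Lemma keeps_mulop f : keeps (mulop f).
Proof. by move=> d v v0 p pd; rewrite /= v0 // scaler0. Qed.
Lemma keeps_C i : keeps (C i).
Proof. by move=> d v v0 p pd; rewrite /= v0 // mulr0. Qed.
Lemma keeps_W s : keeps (W s).
Proof. by move=> d v v0 p pd; rewrite /= v0 ?mulr0 //= deg_eperm. Qed.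
Lemma keeps_Rop i j : keeps (R i j).
Proof.
apply: keepsD; first exact: keeps_mulop.
by apply/keepsN/keepsM; [exact: keeps_mulop | apply: keepsM; exact: keeps_C].
Qed.

(** The image of alpha x_i + z_i; the parameter of [shifted] is 0 because alpha
    has been absorbed in the action of y_i. *)
Definition zop i : linop V := shifted X (fun j => E j + dunkl W R j) C W 0 i.

Definition zlow i : linop V :=
  dunkl W R i * X i + \sum_(k < n | (k < i)%N) jm_term C W i k.

Lemma keeps_zlow i : keeps (zlow i).
Proof.
apply: keepsD.
  apply: keepsM; last exact: keeps_mulop.
  apply: keeps_sum => k _; apply: keepsM; [exact: keeps_Rop | exact: keeps_W].
apply: keeps_sum => k _; apply: keepsM; last exact: keeps_W.
by apply/keepsD/keepsN/keepsM; [exact: keeps1 | exact: keeps_C | exact: keeps_C].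
Qed.

Lemma zop_apply i v (p : point K n * expo n) :
  zop i v p = val p.1 i *: v (p.1, p.2 - unitexp i) + zlow i v p.
Proof.
have -> : zop i = E i * X i + zlow i.
  by rewrite /zop /shifted mul0r add0r mulrDl -addrA.
by [].
Qed.

(** Constant in x and of degree 0 in E. *)
Definition vac g : V := fun p => if p.2 == 0 then g else 0.
(** Two words have the same content exactly when they are permutations of one
    another, which is when the corresponding monomials in E agree. *)
Definition content l : expo n := \sum_(i <- l) unitexp i.

Lemma contentE l j : content l j = (count_mem j l)%:Z.
Proof.
rewrite /content; elim: l => [|i l IH]; first by rewrite big_nil ffunE.
by rewrite big_cons ffunE IH ffunE eq_sym PoszD.
Qed.

Lemma content_perm l l' : content l = content l' -> perm_eq l l'.
Proof.
move/ffunP => ll'; apply/allP => j _ /=.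
by move: (ll' j); rewrite !contentE => -[->].
Qed.

Lemma deg_content l : deg (content l) = size l.
Proof.
rewrite /content; elim: l => [|i l IH] /=.
  by rewrite big_nil deg0.
rewrite big_cons -[unitexp i]opprK addrC degB IH -sub0r degB deg_unitexp deg0.
by rewrite sub0r opprK intS addrC.
Qed.

(** Each letter raises the degree in E by at most one. *)
Lemma word_vanish l g d : ((size l)%:Z < d)%R -> vanish d (word zop l (vac g)).
Proof.
elim: l d => [|i l IH] d ld p pd.
  rewrite word_nil -[LHS]/(vac g p) /vac; case: eqP => // p0.
  by move: ld; rewrite -pd p0 deg0.
have ld' : ((size l)%:Z < d - 1)%R by rewrite ltrBrDr addrC -intS.
rewrite word_cons -[LHS]/(zop i (word zop l (vac g)) p) zop_apply.
rewrite (IH (d - 1)) ?scaler0 //; last by rewrite degB deg_unitexp pd.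
rewrite (@keeps_zlow i d) ?addr0 // => q qd; apply: (IH d) => //.
by rewrite -(subrK 1 d) ltr_wpDr.
Qed.

(** In the top degree only the summand E i * X i of each letter contributes. *)
Lemma word_top l g (p : point K n * expo n) : deg p.2 = size l ->
  word zop l (vac g) p =
  if p.2 == content l then (\prod_(i <- l) val p.1 i) *: g else 0.
Proof.
elim: l p => [|i l IH] p pd.
  by rewrite word_nil /content !big_nil scale1r.
rewrite word_cons -[LHS]/(zop i (word zop l (vac g)) p) zop_apply.
rewrite (@keeps_zlow i (size l).+1) ?addr0 //; last first.
  by apply: word_vanish; rewrite ltz_nat.
rewrite IH /=; last by rewrite degB deg_unitexp pd /= intS addrC addKr.
rewrite subr_eq /content !big_cons addrC.
by case: eqP => _; rewrite ?scaler0 // scalerA.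
Qed.

End Independence.

(** * Injectivity *)

Lemma palg_scalar_rmorphism (K : fieldType) (G : Type)
    (rel : aterm K G -> aterm K G -> Prop) :
  exists F : {rmorphism K -> palg rel}, forall k, F k = k *: (1 : palg rel).
Proof.
have [|k l|k l|F FE] := @rmorphism_of K (palg rel) (fun k => k *: (1 : palg rel)).
- by rewrite scale1r.
- by rewrite scalerDl.
- by rewrite -palg_scalerAl mul1r scalerA.
by exists F.
Qed.

Lemma seq_argmax (T : eqType) (f : T -> nat) (w : seq T) : w != [::] ->
  exists2 t0, t0 \in w & forall t, t \in w -> (f t <= f t0)%N.
Proof.
elim: w => // t w IH _; have [->|/IH[t0 t0w t0P]] := eqVneq w [::].
  by exists t; rewrite ?mem_head // => t'; rewrite mem_seq1 => /eqP ->.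
have [le|lt] := leqP (f t) (f t0).
  exists t0; first by rewrite inE t0w orbT.
  by move=> t'; rewrite inE => /orP[/eqP -> //|/t0P].
exists t; first exact: mem_head.
move=> t'; rewrite inE => /orP[/eqP -> //|/t0P le].
exact: leq_trans le (ltnW lt).
Qed.

(** The homomorphism [tau] is the composite of the Dunkl representation with the
    map to the double affine algebra; leading coefficients are evaluated at the
    generic point [x0]. *)
Section Injectivity.
Variables (K : fieldType) (n : nat) (x0 : point K n).
Local Notation H := (dahc K n).
Local Notation a i := (pgen (@dahc_rel K n) (DA i)).
Local Notation c i := (pgen (@dahc_rel K n) (DC i)).
Local Notation S s := (pgen (@dahc_rel K n) (DS s)).
Local Notation av := (fun i => a i).
Local Notation Z := (@zop K n).
Variable tau : {rmorphism H -> linop (vspc K n)}.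
Hypothesis tauK : forall k, tau (k *: (1 : H)) = mulop (fun=> k).
Hypothesis tau_a : forall i, tau (a i) = Z i.
Hypothesis tau_c : forall i, tau (c i) = Cop K i.
Hypothesis tau_S : forall s, tau (S s) = Wop K s.

Lemma tau_word l : tau (word av l) = word Z l.
Proof.
rewrite /word rmorph_prod.
by apply: eq_bigr => i _; rewrite tau_a.
Qed.

Lemma word_a_perm l l' : perm_eq l l' -> word av l = word av l'.
Proof. by apply: word_perm; apply: (relBB (@dahc_relationsP K n)). Qed.

Lemma word_Z_perm l l' : perm_eq l l' -> word Z l = word Z l'.
Proof. by move=> ll'; rewrite -!tau_word (word_a_perm ll'). Qed.

Lemma vac_sum I (r : seq I) (P : pred I) (g : I -> sergeev K n) :
  \sum_(i <- r | P i) vac (g i) = vac (\sum_(i <- r | P i) g i).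
Proof.
apply/funext => p; rewrite fct_sumE /vac; case: eqP => _ //.
by rewrite big1.
Qed.

Variable iota : {rmorphism sergeev K n -> H}.
Hypothesis iotaK : forall k, iota (k *: (1 : sergeev K n)) = k *: (1 : H).
Hypothesis iotac : forall i, iota (sergeev_c K i) = c i.
Hypothesis iotaS : forall s, iota (sergeev_S K s) = S s.

(** The vacuum vectors are invariant under sign changes and permutations, so the
    Sergeev part acts on them by left multiplication on the value. *)
Lemma tau_iota_vac g h : tau (iota g) (vac h) = vac (g * h).
Proof.
elim/palg_ind: g h => [[i|s]|k|g1 g2 IH1 IH2|g1 g2 IH1 IH2] h.
- rewrite iotac tau_c; apply/funext => p; rewrite /= /vac /=.
  by case: eqP => _; rewrite ?mulr0.
- rewrite iotaS tau_S; apply/funext => p; rewrite /= /vac /=.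
  have -> : (eperm s p.2 == 0) = (p.2 == 0).
    apply/eqP/eqP => [p0|->]; apply/ffunP => i; last by rewrite !ffunE.
    by move/ffunP: p0 => /(_ (s^-1 i)%g); rewrite !ffunE permKV.
  by case: eqP => _; rewrite ?mulr0.
- rewrite iotaK tauK; apply/funext => p; rewrite /= /vac /= -palg_scalerAl mul1r.
  by case: eqP => _; rewrite ?scaler0.
- rewrite !rmorphD mulrDl -[LHS]/(tau (iota g1) _ + tau (iota g2) _) IH1 IH2.
  by apply/funext => p; rewrite /vac -[LHS]/(_ p + _ p) /=; case: eqP; rewrite ?addr0.
- by rewrite !rmorphM -mulrA -IH1 -IH2.
Qed.

Lemma tau_comb w : tau (comb iota w) (vac 1) = \sum_(t <- w) word Z t.1 (vac t.2).
Proof.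
rewrite /comb rmorph_sum linopE_sum; apply: eq_bigr => t _.
by rewrite rmorphM -[LHS]/(tau _ (tau _ _)) tau_iota_vac mulr1 tau_word.
Qed.

(** Induction on the number of terms.  Take a word l0 of maximal length and look
    at the coefficient of the monomial E^(content l0): only the permutations of
    l0 contribute, with the same nonzero scalar, so that the sum g of their
    coefficients vanishes.  As the letters commute, these terms then add up to 0
    on both sides and can be removed. *)
Lemma comb_eq0 w : \sum_(t <- w) word Z t.1 (vac t.2) = 0 -> comb iota w = 0.
Proof.
move: {2}(size w) (leqnn (size w)) => m; elim: m w => [|m IH] w.
  by rewrite leqn0 size_eq0 => /eqP -> _; rewrite /comb big_nil.
move=> wm w0; have [->|w_neq0] := eqVneq w [::]; first by rewrite /comb big_nil.
have [t0 t0w t0P] := seq_argmax (fun t => size t.1) w_neq0.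
set l0 := t0.1 in t0P.
pose P (t : seq 'I_n * sergeev K n) := content t.1 == content l0.
have Pperm t : P t -> perm_eq t.1 l0 by move/eqP/content_perm.
pose g := \sum_(t <- w | P t) t.2.
have g_eq0 : g = 0.
  pose x := \prod_(i <- l0) val x0 i.
  have x_neq0 : x != 0.
    by rewrite prodf_seq_neq0; apply/allP => i _; apply: point_neq0.
  have := congr1 (fun v => v (x0, content l0)) w0.
  rewrite fct_sumE /= big_seq.
  rewrite (eq_bigr (fun t => if P t then x *: t.2 else 0)) => [|t tw]; last first.
    have [st|ne] := eqVneq (size t.1) (size l0).
      rewrite word_top /= ?deg_content ?st // eq_sym -/(P t).
      case: ifP => // /Pperm pt; congr (_ *: _).
      by apply: perm_big.
    have lt : (size t.1 < size l0)%N by rewrite ltn_neqAle ne t0P.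
    rewrite (@word_vanish _ _ _ _ (size l0)) /= ?deg_content ?ltz_nat //.
    by case: ifP => // /Pperm /perm_size st; rewrite st eqxx in ne.
  rewrite -big_seq -big_mkcond -scaler_sumr -/g => /eqP.
  by rewrite scaler_eq0 (negPf x_neq0) => /eqP.
have wP0 : \sum_(t <- w | P t) word Z t.1 (vac t.2) = 0.
  rewrite (eq_bigr (fun t => word Z l0 (vac t.2))) => [|t /Pperm pt].
    rewrite -linop_sum vac_sum -/g g_eq0.
    rewrite (_ : vac 0 = 0) ?linop0 //.
    by apply/funext => p; rewrite /vac; case: ifP.
  by rewrite (word_Z_perm pt).
have cP0 : \sum_(t <- w | P t) word av t.1 * iota t.2 = 0.
  rewrite (eq_bigr (fun t => word av l0 * iota t.2)) => [|t /Pperm pt].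
    by rewrite -mulr_sumr -rmorph_sum -/g g_eq0 rmorph0 mulr0.
  by rewrite (word_a_perm pt).
move: w0; rewrite (bigID P) /= wP0 add0r -big_filter => w0.
rewrite /comb (bigID P) /= cP0 add0r -big_filter; apply: IH w0.
rewrite -ltnS; apply: leq_trans wm; rewrite size_filter.
rewrite -[X in (_ < X)%N](count_predC P) -[X in (X < _)%N]add0n ltn_add2r.
by rewrite -has_count; apply/hasP; exists t0; rewrite // /P eqxx.
Qed.

Lemma tau_inj : injective tau.
Proof.
apply: raddf_inj => p tp.
have [w def_p] := spanned_all iotaK iotac iotaS p.
rewrite def_p; apply: comb_eq0.
by rewrite -tau_comb -def_p tp.
Qed.

End Injectivity.

(** * The isomorphism *)

Lemma dahc_relations_inj (A A' : pzRingType) (f : {rmorphism A -> A'}) n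
    (B C : 'I_n -> A) (W : 'S_n -> A) : injective f ->
  dahc_relations (f \o B) (f \o C) (f \o W) -> dahc_relations B C W.
Proof.
move=> f_inj rel; split; first split.
- by apply: f_inj; rewrite rmorph1; apply: relW1 rel.
- by move=> s t; apply: f_inj; rewrite rmorphM; apply: relWM rel _ _.
- by move=> s i; apply: f_inj; rewrite !rmorphM; apply: relWC rel _ _.
- by move=> i; apply: f_inj; rewrite rmorphM rmorph1; apply: relC2 rel _.
- by move=> i j ij; apply: f_inj; rewrite rmorphN !rmorphM; apply: relCC rel _ _ ij.
- by move=> i i' j e ji ji'; apply: f_inj; rewrite !rmorphM; apply: relBW rel _ _ _ e ji ji'.
- move=> i i' e; apply: f_inj; rewrite !rmorphB !rmorphM rmorph1.
  exact: relBWs rel _ _ e.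
- by move=> i; apply: f_inj; rewrite rmorphN !rmorphM; apply: relCB rel _.
- by move=> i j; apply: f_inj; rewrite !rmorphM; apply: relBB rel _ _.
- by move=> i j ij; apply: f_inj; rewrite !rmorphM; apply: relCBn rel _ _ ij.
Qed.

Section Isomorphism.
Variables (K : fieldType) (n : nat) (u : K) (alpha : K).
Hypothesis u_neq0 : u != 0.
Variable x0 : point K n.

Local Notation A := (subalg (@shifted_gens K n u alpha)).
Local Notation L := (linop (vspc K n)).

Lemma subalg_scalar_rmorphism :
  exists F : {rmorphism K -> A}, forall k, F k = k *: (1 : A).
Proof.
have [|k l|k l|F FE] := @rmorphism_of K A (fun k => k *: (1 : A)).
- by rewrite scale1r.
- by rewrite scalerDl.
- apply: val_inj.
  by rewrite rmorphM /= -palg_scalerAl mul1r scalerA.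
by exists F.
Qed.

Lemma rdahc_shiftedE i :
  shifted (@rdahc_x K n u) (fun j => u^-1 *: rdahc_y u j) (@rdahc_c K n u)
    (@rdahc_S K n u) (alpha *: (1 : rdahc n u)) i =
  alpha *: rdahc_x u i + rdahc_z u i.
Proof.
by rewrite /shifted /rdahc_z -!palg_scalerAl mul1r addrA.
Qed.

Let Bs i : A := Subalg (mem_gen_subalg (@shifted_gens_z K n u alpha i)).
Let Cs i : A := Subalg (mem_gen_subalg (@shifted_gens_c K n u alpha i)).
Let Ws s : A := Subalg (mem_gen_subalg (@shifted_gens_S K n u alpha s)).

Lemma subalg_dahc_relations : dahc_relations Bs Cs Ws.
Proof.
apply: (@dahc_relations_inj _ _ (val : {rmorphism A -> rdahc n u})); first exact: val_inj.
have aC (b : rdahc n u) : (alpha *: (1 : rdahc n u)) * b = b * (alpha *: (1 : rdahc n u)).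
  by rewrite -palg_scalerAl -palg_scalerAr mul1r mulr1.
have := shifted_dahc (rdahc_relationsP n u_neq0) aC.
by congr dahc_relations; apply/funext => i; apply: rdahc_shiftedE.
Qed.

Lemma linop_scalar_rmorphism :
  exists F : {rmorphism K -> L}, forall k, F k = mulop (fun=> k).
Proof.
have [|k l|k l|F FE] := @rmorphism_of K L (fun k => mulop (fun=> k)).
- exact: mulop1.
- by rewrite mulopD.
- by rewrite mulopM.
by exists F.
Qed.

(** The element y_i acts as u (E_i - alpha + D_i).  Hence alpha x_i + u^-1 y_i x_i
    acts as (E_i + D_i) x_i. *)
Lemma rdahc_representation : exists rho : {rmorphism rdahc n u -> L},
  [/\ forall k, rho (k *: (1 : rdahc n u)) = mulop (fun=> k),
      forall i, rho (alpha *: rdahc_x u i + rdahc_z u i) = zop K i,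
      forall i, rho (rdahc_c u i) = Cop K i
    & forall s, rho (rdahc_S u s) = Wop K s].
Proof.
have [F FE] := linop_scalar_rmorphism.
have FC k T : F k * T = T * F k by rewrite FE mulop_central.
have [rho [rhoK [rhox rhoy] rhoc rhoS]] :=
  rdahc_hom FC u (dunkl_rdahc (op_dunkl_relations n alpha)).
exists rho; split=> // [k|i]; first by rewrite rhoK FE.
have rhoZ k (b : rdahc n u) : rho (k *: b) = F k * rho b.
  by rewrite -rhoK -rmorphM -palg_scalerAl mul1r.
rewrite rmorphD rmorphD !rhoZ rmorphM rhox rhoy.
rewrite -(mulrA (F u)) (mulrA (F u^-1)) -rmorphM mulVf // rmorph1 mul1r.
rewrite /zop /shifted mul0r add0r addrA; congr (_ + _).
  by rewrite -mulrDl FE addrC -addrA [dunkl _ _ _ + _]addrC addrA subrK.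
rewrite rmorph_sum; apply: eq_bigr => k _.
by rewrite rmorphM rmorphB rmorph1 rmorphM !rhoc rhoS.
Qed.

Lemma dahc_iso_subalg :
  exists f : {rmorphism dahc K n -> A}, scalable f /\ bijective f.
Proof.
have [F FE] := subalg_scalar_rmorphism.
have FZ k (b : A) : F k * b = k *: b.
  by apply: val_inj; rewrite FE /= -palg_scalerAl mul1r.
have FC k b : F k * b = b * F k.
  by rewrite FZ FE; apply: val_inj; rewrite /= -palg_scalerAr mulr1.
have [f [fK fa fc fS]] := dahc_hom FC subalg_dahc_relations.
exists f; split.
  by move=> k p; rewrite -[p in LHS]mul1r palg_scalerAl rmorphM fK FZ.
have [rho [rhoK rhoz rhoc rhoS]] := rdahc_representation.
have [G GE] := palg_scalar_rmorphism (@dahc_rel K n).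
have GC k p : G k * p = p * G k.
  by rewrite GE -palg_scalerAl -palg_scalerAr mul1r mulr1.
have [iota [iotaK iotac iotaS]] := sergeev_hom GC (dahc_relationsP K n).
have f_inj : injective f.
  pose tau : {rmorphism dahc K n -> L} := rho \o (val \o f).
  have inj_tau : injective tau.
    apply: (@tau_inj K n x0 tau _ _ _ _ iota) => //.
    - by move=> k; rewrite /tau /= fK FE /= rhoK.
    - by move=> i; rewrite /tau /= fa /= rhoz.
    - by move=> i; rewrite /tau /= fc /= rhoc.
    - by move=> s; rewrite /tau /= fS /= rhoS.
    - by move=> k; rewrite iotaK GE.
  by move=> p q fpq; apply: inj_tau; rewrite /tau /= fpq.
have f_surj (b : A) : exists p, f p = b.
  pose im : {pred rdahc n u} := fun r => `[< exists p, val (f p) = r >].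
  have imP r : reflect (exists p, val (f p) = r) (r \in im) by apply: asboolP.
  suff /imP[p fp] : val b \in im by exists p; apply: val_inj.
  have /gen_subalgP := valP b; apply.
  - split=> [|_ _ /imP[p <-] /imP[q <-]|_ _ /imP[p <-] /imP[q <-]]; apply/imP.
    + by exists 1; rewrite rmorph1.
    + by exists (p - q); rewrite !rmorphB.
    + by exists (p * q); rewrite !rmorphM.
  - split=> [|k _ _ /imP[p <-] /imP[q <-]]; apply/imP.
    + by exists 0; rewrite rmorph0.
    + by exists ((k *: (1 : dahc K n)) * p + q); rewrite rmorphD rmorphM fK FZ.
  - move=> _ [i|i|s]; apply/imP.
    + by exists (pgen (@dahc_rel K n) (DC i)); rewrite fc.
    + by exists (pgen (@dahc_rel K n) (DA i)); rewrite fa.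
    + by exists (pgen (@dahc_rel K n) (DS s)); rewrite fS.
pose g b := projT1 (cid (f_surj b)).
have fg : cancel g f by move=> b; apply: (projT2 (cid (f_surj b))).
by exists g => // p; apply: f_inj; rewrite fg.
Qed.

End Isomorphism.

(** In characteristic 0 the point (1, 2, ..., n) is generic. *)
Lemma generic_natr (K : numFieldType) n : generic [ffun i : 'I_n => i.+1%:R : K].
Proof.
apply/genericP; split=> [i|i j ij]; rewrite !ffunE ?pnatr_eq0 //.
by rewrite -!natrX eqr_nat eqn_exp2r.
Qed.

Theorem theorem2p10 (R : realType) (n : nat) (n_gt0 : (0 < n)%N)
    (u : R[i]) (u_neq0 : u != 0) (alpha : R[i]) :
  exists f : {rmorphism dahc R[i] n -> subalg (@shifted_gens R[i] n u alpha)},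
    scalable f /\ bijective f.
Proof.
have x0 : point R[i] n by exists [ffun i : 'I_n => i.+1%:R]; exact: generic_natr.
exact: (dahc_iso_subalg alpha u_neq0 x0).
Qed.
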